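(* Let $\Gamma$ be a finite simplicial graph such that $\mathbb{A}(\Gamma)$ is a non-elementary right-angled Artin group. Then $\mathbb{A}(\Gamma)$ is irreducible if and only if it has pure exponential growth and, for every vertex $v$ of $\Gamma$, the generic excursion in the vertex group $\langle v\rangle$ is asymptotically logarithmic.
   Context: For a finite simplicial graph $\Gamma$, the right-angled Artin group is $\mathbb{A}(\Gamma)=\langle v \text{ a vertex of }\Gamma \mid [v,w]=1 \text{ whenever } (v,w)\text{ is an edge of }\Gamma\rangle$. The standard generating set consists of the vertices of $\Gamma$ (and their inverses); $\|g\|$ is the corresponding word length. The opposite graph $\Gamma^{op}$ has the same vertices as $\Gamma$, and its edge set is the complement of that of $\Gamma$. $\mathbb{A}(\Gamma)$ is irreducible if $\Gamma^{op}$ is connected, and non-elementary if $\Gamma$ has at least two vertices. Write $G=\mathbb{A}(\Gamma)$, $S_n=\{g\in G:\|g\|=n\}$, $B_n=\{g\in G:\|g\|\le n\}$, and let $P_n$ be the uniform probability measure on $S_n$. The growth rate is $\lambda=\lim_{n\to\infty}(\#B_n)^{1/n}$; $G$ has exponential growth if $\lambda>1$. $G$ has pure exponential growth if it has exponential growth and there is a constant $C>0$ with $\frac1C\leq\frac{\#S_n}{\lambda^n}\leq C$ for all $n$. Excursion: for a subgroup $H<G$ and a geodesic segment $\gamma$ in the Cayley graph of $G$, set $\mathcal{E}_H(\gamma)=\max_{t\in G}\mathrm{diam}(\gamma\cap tH)$; for $g\in G$, $\mathcal{E}_H(g)$ is the maximum of $\mathcal{E}_H(\gamma)$ over all geodesic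 segments $\gamma$ joining $1$ and $g$. The (generic) excursion in $H$ is asymptotically logarithmic if there exist constants $c_1,c_2>0$ such that $P_n\left(g\in G: c_1\leq\frac{\mathcal{E}_H(g)}{\log n}\leq c_2\right)\to1$ as $n\to\infty$. *)

(* Defs.v *)
From HB Require Import structures.
From mathcomp Require Import all_boot all_order all_algebra.
From mathcomp Require Import finmap.
From mathcomp Require Import all_classical all_reals all_analysis.

Set Implicit Arguments.
Unset Strict Implicit.
Unset Printing Implicit Defensive.

Import Order.TTheory GRing.Theory Num.Theory.
Import numFieldNormedType.Exports.

Local Open Scope classical_set_scope.
Local Open Scope quotient_scope.
Local Open Scope group_scope.

(* The letter (x, false) stands for the generator x, and (x, true) for its
   formal inverse. *)
Definition word (X : Type) := seq (X * bool).

Definition flip_letter (X : Type) (l : X * bool) : X * bool := (l.1, ~~ l.2).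

Definition inv_word (X : Type) (w : word X) : word X :=
  rev (map (@flip_letter X) w).

(* The least congruence on words containing free cancellation and r ~ [::] for
   each relator r in Rel. *)
Inductive presentation_eq (X : Type) (Rel : set (word X)) :
    word X -> word X -> Prop :=
| pres_refl w : presentation_eq Rel w w
| pres_sym w1 w2 : presentation_eq Rel w1 w2 -> presentation_eq Rel w2 w1
| pres_trans w1 w2 w3 : presentation_eq Rel w1 w2 ->
    presentation_eq Rel w2 w3 -> presentation_eq Rel w1 w3
| pres_cancel u v l :
    presentation_eq Rel (u ++ [:: l; flip_letter l] ++ v) (u ++ v)
| pres_relator u v r : Rel r -> presentation_eq Rel (u ++ r ++ v) (u ++ v).

Lemma flip_letterK (X : Type) : involutive (@flip_letter X).
Proof. by case=> x b; rewrite /flip_letter /= negbK. Qed.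

Lemma inv_wordK (X : Type) : involutive (@inv_word X).
Proof.
by move=> w; rewrite /inv_word map_rev revK; apply/mapK/flip_letterK.
Qed.

Lemma inv_word_cat (X : Type) (u v : word X) :
  inv_word (u ++ v) = inv_word v ++ inv_word u.
Proof. by rewrite /inv_word map_cat rev_cat. Qed.

Lemma presentation_eq_catl (X : Type) (Rel : set (word X)) (u w1 w2 : word X) :
  presentation_eq Rel w1 w2 -> presentation_eq Rel (u ++ w1) (u ++ w2).
Proof.
elim=> [w|v1 v2 _ IH|v1 v2 v3 _ IH1 _ IH2|a b l|a b r Rr].
- exact: pres_refl.
- exact: pres_sym.
- exact: pres_trans IH1 IH2.
- by rewrite (catA u a) (catA u a b); apply: pres_cancel.
- by rewrite (catA u a) (catA u a b); apply: pres_relator.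
Qed.

Lemma presentation_eq_catr (X : Type) (Rel : set (word X)) (u w1 w2 : word X) :
  presentation_eq Rel w1 w2 -> presentation_eq Rel (w1 ++ u) (w2 ++ u).
Proof.
elim=> [w|v1 v2 _ IH|v1 v2 v3 _ IH1 _ IH2|a b l|a b r Rr].
- exact: pres_refl.
- exact: pres_sym.
- exact: pres_trans IH1 IH2.
- by rewrite -!catA; apply: pres_cancel.
- by rewrite -!catA; apply: pres_relator.
Qed.

Lemma presentation_eq_cat (X : Type) (Rel : set (word X))
    (u1 u2 w1 w2 : word X) :
  presentation_eq Rel u1 u2 -> presentation_eq Rel w1 w2 ->
  presentation_eq Rel (u1 ++ w1) (u2 ++ w2).
Proof.
move=> eu ew; apply: (pres_trans (presentation_eq_catr w1 eu)).
exact: presentation_eq_catl.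
Qed.

Lemma presentation_eq_mulV (X : Type) (Rel : set (word X)) (w : word X) :
  presentation_eq Rel (inv_word w ++ w) [::].
Proof.
elim: w => [|l w IH]; first exact: pres_refl.
rewrite -cat1s inv_word_cat -catA; apply: pres_trans IH.
have := pres_cancel Rel (inv_word w) w (flip_letter l).
by rewrite flip_letterK.
Qed.

Lemma presentation_eq_inv (X : Type) (Rel : set (word X)) (w1 w2 : word X) :
  presentation_eq Rel w1 w2 ->
  presentation_eq Rel (inv_word w1) (inv_word w2).
Proof.
move=> e12.
have e1 : presentation_eq Rel (inv_word w1 ++ (w2 ++ inv_word w2)) (inv_word w1).
  have := presentation_eq_mulV Rel (inv_word w2); rewrite inv_wordK => e2.
  by have := presentation_eq_catl (inv_word w1) e2; rewrite cats0.
apply: pres_trans (pres_sym e1) _.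
rewrite catA -[X in presentation_eq _ _ X]cat0s.
apply: presentation_eq_catr; apply: pres_trans (presentation_eq_mulV Rel w1).
exact/presentation_eq_catl/pres_sym.
Qed.

Definition presentation_rel (X : choiceType) (Rel : set (word X)) :
  rel (word X) := fun w1 w2 => `[< presentation_eq Rel w1 w2 >].

Lemma presentation_relP (X : choiceType) (Rel : set (word X)) :
  equiv_class_of (presentation_rel Rel).
Proof.
split=> [w|w1 w2|w2 w1 w3].
- exact/asboolP/pres_refl.
- by apply/asboolP/asboolP; apply: pres_sym.
- by move=> /asboolP e12 /asboolP e23; apply/asboolP/(pres_trans e12).
Qed.

Canonical presentation_equiv (X : choiceType) (Rel : set (word X)) :=
  EquivRelPack (presentation_relP Rel).

(* The group < X | Rel >. *)
Definition presented (X : choiceType) (Rel : set (word X)) :=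
  {eq_quot (presentation_equiv Rel)}.

HB.instance Definition _ (X : choiceType) (Rel : set (word X)) :=
  Choice.on (presented Rel).
HB.instance Definition _ (X : choiceType) (Rel : set (word X)) :=
  EqQuotient.on (presented Rel).

Definition presented_one (X : choiceType) (Rel : set (word X)) :
  presented Rel := \pi_(presented Rel) [::].
Definition presented_mul (X : choiceType) (Rel : set (word X))
  (g h : presented Rel) : presented Rel :=
  \pi_(presented Rel) (repr g ++ repr h).
Definition presented_inv (X : choiceType) (Rel : set (word X))
  (g : presented Rel) : presented Rel :=
  \pi_(presented Rel) (inv_word (repr g)).

Lemma presented_piP (X : choiceType) (Rel : set (word X)) (w1 w2 : word X) :
  \pi_(presented Rel) w1 = \pi_(presented Rel) w2 <-> presentation_eq Rel w1 w2.
Proof.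
split; first by move=> /eqmodP /asboolP.
by move=> e12; apply/eqmodP/asboolP.
Qed.

Lemma presented_repr (X : choiceType) (Rel : set (word X)) (w : word X) :
  presentation_eq Rel (repr (\pi_(presented Rel) w)) w.
Proof. by apply/presented_piP; rewrite reprK. Qed.

Lemma presented_mulE (X : choiceType) (Rel : set (word X)) (w1 w2 : word X) :
  presented_mul (\pi_(presented Rel) w1) (\pi_(presented Rel) w2) =
  \pi_(presented Rel) (w1 ++ w2).
Proof.
by apply/presented_piP; apply: presentation_eq_cat; apply: presented_repr.
Qed.

Lemma presented_invE (X : choiceType) (Rel : set (word X)) (w : word X) :
  presented_inv (\pi_(presented Rel) w) = \pi_(presented Rel) (inv_word w).
Proof. by apply/presented_piP/presentation_eq_inv; apply: presented_repr. Qed.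

Lemma presented_mulA (X : choiceType) (Rel : set (word X)) :
  associative (@presented_mul X Rel).
Proof.
move=> g h k; rewrite -[g]reprK -[h]reprK -[k]reprK.
rewrite (presented_mulE Rel (repr h)) (presented_mulE Rel (repr g) (repr h)).
by rewrite !presented_mulE catA.
Qed.

Lemma presented_mul1 (X : choiceType) (Rel : set (word X)) :
  left_id (presented_one Rel) (@presented_mul X Rel).
Proof. by move=> g; rewrite -[g]reprK presented_mulE. Qed.

Lemma presented_1mul (X : choiceType) (Rel : set (word X)) :
  right_id (presented_one Rel) (@presented_mul X Rel).
Proof. by move=> g; rewrite -[g]reprK presented_mulE cats0. Qed.

Lemma presented_mulV (X : choiceType) (Rel : set (word X)) :
  left_inverse (presented_one Rel) (@presented_inv X Rel) (@presented_mul X Rel).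
Proof.
move=> g; rewrite -[g]reprK presented_invE presented_mulE.
by apply/presented_piP; apply: presentation_eq_mulV.
Qed.

Lemma presented_Vmul (X : choiceType) (Rel : set (word X)) :
  right_inverse (presented_one Rel) (@presented_inv X Rel) (@presented_mul X Rel).
Proof.
move=> g; rewrite -[g]reprK presented_invE presented_mulE.
apply/presented_piP; rewrite -{1}[repr g]inv_wordK.
exact: presentation_eq_mulV.
Qed.

HB.instance Definition _ (X : choiceType) (Rel : set (word X)) :=
  isGroup.Build (presented Rel) (@presented_mulA X Rel) (@presented_mul1 X Rel)
    (@presented_1mul X Rel) (@presented_mulV X Rel) (@presented_Vmul X Rel).

Definition gen (X : choiceType) (Rel : set (word X)) (x : X) : presented Rel :=
  \pi_(presented Rel) [:: (x, false)].

Lemma represented_by_word (X : choiceType) (Rel : set (word X))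
    (g : presented Rel) :
  exists n, `[< exists w : word X, size w = n /\ \pi_(presented Rel) w = g >].
Proof. by exists (size (repr g)); apply/asboolP; exists (repr g); rewrite reprK. Qed.

Definition word_length (X : choiceType) (Rel : set (word X))
  (g : presented Rel) : nat := ex_minn (represented_by_word g).

Definition word_dist (X : choiceType) (Rel : set (word X))
  (g h : presented Rel) : nat := word_length (g^-1 * h).

Definition sphere (X : choiceType) (Rel : set (word X)) (n : nat) :
  set (presented Rel) := [set g | word_length g = n].

Definition word_ball (X : choiceType) (Rel : set (word X)) (n : nat) :
  set (presented Rel) := [set g | (word_length g <= n)%N].

Lemma finite_word_ball (X : finType) (Rel : set (word X)) (n : nat) :
  finite_set (@word_ball X Rel n).
Proof.
pose W := \bigcup_(k in `I_n.+1) range (fun t : k.-tuple (X * bool)%type => tval t).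
apply: (@sub_finite_set _ _ ((fun w => \pi_(presented Rel) w) @` W)).
  move=> g /=; rewrite /word_ball /word_length /=.
  case: ex_minnP => m /asboolP[w [sw <-]] _ mn; exists w => //.
  exists m; first by rewrite /= ltnS.
  by exists (tcast sw (in_tuple w)) => //; rewrite val_tcast.
apply: finite_image; apply: bigcup_finite; first exact: finite_II.
by move=> k _; apply: finite_image; apply: finite_finset.
Qed.

Lemma finite_sphere (X : finType) (Rel : set (word X)) (n : nat) :
  finite_set (@sphere X Rel n).
Proof.
by apply: sub_finite_set (finite_word_ball Rel n) => g /= <-; apply: leqnn.
Qed.

(* Meaningful for finite A only; fset_set A is empty otherwise. *)
Definition set_card (T : choiceType) (A : set T) : nat := #|` fset_set A|%fset.

Local Open Scope ring_scope.

(* P_n(A), the probability of A under the uniform measure on the n-sphere. *)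
Definition sphere_prob (R : realType) (X : finType) (Rel : set (word X))
  (n : nat) (A : set (presented Rel)) : R :=
  (set_card (sphere n `&` A))%:R / (set_card (@sphere X Rel n))%:R.

Definition growth_rate (R : realType) (X : finType) (Rel : set (word X)) : R :=
  lim ((fun n : nat => (set_card (@word_ball X Rel n))%:R `^ n%:R^-1) @ \oo).

Definition exponential_growth (R : realType) (X : finType)
  (Rel : set (word X)) : Prop := 1 < growth_rate R Rel.

Definition pure_exponential_growth (R : realType) (X : finType)
  (Rel : set (word X)) : Prop :=
  exponential_growth R Rel /\
  exists C : R, 0 < C /\
    forall n : nat,
      C^-1 <= (set_card (@sphere X Rel n))%:R / growth_rate R Rel ^+ n <= C.

Definition subgroup_generated (G : groupType) (A : set G) : set G :=
  smallest (fun H : set G => group_closed (mem H)) A.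

Definition left_coset (G : groupType) (t : G) (H : set G) : set G :=
  [set (t * h)%g | h in H].

Definition cayley (X : choiceType) (Rel : set (word X)) : rel (presented Rel) :=
  fun g h => `[< exists x : X,
    h = (g * gen Rel x)%g \/ h = (g * (gen Rel x)^-1)%g >].

(* A geodesic segment from g to h, given by the sequence g :: p of the vertices
   it visits. *)
Definition geodesic (X : choiceType) (Rel : set (word X)) (g h : presented Rel)
  (p : seq (presented Rel)) : Prop :=
  [/\ path (@cayley X Rel) g p, last g p = h & size p = word_dist g h].

(* Below, sup is taken over bounded sets of integers, so that it is a maximum,
   except that sup set0 = 0 gives the empty set diameter 0. *)
Definition diam (R : realType) (X : choiceType) (Rel : set (word X))
  (A : set (presented Rel)) : R :=
  sup [set (word_dist a.1 a.2)%:R | a in A `*` A].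

Definition path_excursion (R : realType) (X : choiceType) (Rel : set (word X))
  (H : set (presented Rel)) (gamma : seq (presented Rel)) : R :=
  sup [set diam R ([set` gamma] `&` left_coset t H) | t in setT].

Definition excursion (R : realType) (X : choiceType) (Rel : set (word X))
  (H : set (presented Rel)) (g : presented Rel) : R :=
  sup [set path_excursion R H (1%g :: p) | p in geodesic 1%g g].

Definition log_excursion (R : realType) (X : finType) (Rel : set (word X))
  (H : set (presented Rel)) : Prop :=
  exists c1 c2 : R, [/\ 0 < c1, 0 < c2 &
    (fun n : nat => sphere_prob R n
       [set g | c1 <= excursion R H g / ln n%:R <= c2]) @ \oo --> (1 : R)].

(* A finite simplicial graph is a symmetric irreflexive relation on a finType. *)

Definition raag_relators (V : finType) (Gamma : rel V) : set (word V) :=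
  [set [:: (p.1, false); (p.2, false); (p.1, true); (p.2, true)]
     | p in [set p : V * V | Gamma p.1 p.2]].

Notation raag Gamma := (presented (raag_relators Gamma)).

Definition vertex_group (V : finType) (Gamma : rel V) (v : V) :
  set (raag Gamma) :=
  subgroup_generated [set gen (raag_relators Gamma) v].
Arguments vertex_group {V} Gamma v _.

Definition opposite_graph (V : finType) (Gamma : rel V) : rel V :=
  fun v w => (v != w) && ~~ Gamma v w.

Definition raag_irreducible (V : finType) (Gamma : rel V) : Prop :=
  forall v w : V, connect (opposite_graph Gamma) v w.

Definition raag_non_elementary (V : finType) : Prop := (2 <= #|V|)%N.

(* Main.v *)
(* Geodesic words are the reduced ones, and two geodesic words of the same
   element differ by commutations only.

   If G is irreducible, take a closed walk p in the opposite graph visiting every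
   vertex, based at a vertex z that does not commute with v. Reading p, then v^k,
   then p backwards between two words w1 and w2 gives, for suitable signs of the
   extreme letters z, a geodesic word such that every geodesic of the same
   element passes through the two ends of v^k. So (w1, w2) can be recovered from
   the element, up to two signs, as soon as the length of w1 is known. With k = 1
   this yields #S_n #S_m <= C #S_(n+m), hence pure exponential growth. For an
   element g without v^k, inserting the connector at each of the n+1 points of a
   geodesic of g is still injective up to signs, because the inserted v^k can be
   located; hence the elements without v^k have proportion O(lambda^k / n).
   Conversely the elements with a factor v^(+-k) have proportion
   O(n lambda^-k), by a union bound over the position of the factor.

   If G is a direct product of two RAAGs, elements of the first factor have zero
   excursion in the vertex groups of the second one. Logarithmic excursions would
   then make the spheres of both factors o(lambda^n), hence, by
   submultiplicativity, summable after division by lambda^n; so would be their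
   convolution, which dominates #S_n / lambda^n >= 1/C. *)
Require Import Defs.
From mathcomp Require Import all_boot all_order all_algebra.
From mathcomp Require Import all_classical all_reals all_analysis.
From mathcomp Require Import finmap zify ring lra.

Set Implicit Arguments.
Unset Strict Implicit.
Unset Printing Implicit Defensive.

Import Order.TTheory GRing.Theory Num.Theory.
Import numFieldNormedType.Exports.

Local Open Scope classical_set_scope.

(** * Trace monoids: reduced words up to commutation, and the action of letters on them *)

Section Traces.
Variables (V : finType) (Gamma : rel V).
Hypothesis Gamma_sym : symmetric Gamma.
Hypothesis Gamma_irr : irreflexive Gamma.
Implicit Types (l m : V * bool) (u w : word V).

Definition comm l m := Gamma l.1 m.1.

Lemma commC l m : comm l m = comm m l. Proof. exact: Gamma_sym. Qed.

Lemma comm_flip l m : comm (flip_letter l) m = comm l m. Proof. by []. Qed.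

Lemma comm_neq l m : comm l m -> l.1 != m.1.
Proof. by rewrite /comm; apply: contraTneq => ->; rewrite Gamma_irr. Qed.

Lemma flip_neq l : (flip_letter l == l) = false.
Proof. by case: l => x []; rewrite /flip_letter xpair_eqE /= andbF. Qed.

(* [front l w] says that w can be rewritten, by commutations only, as a word
   with first letter l; dually, the final letters of w are the [l] such that
   [front l (rev w)]. *)
Fixpoint front l w :=
  if w is m :: w' then (l == m) || (comm l m && front l w') else false.

Fixpoint reduced w :=
  if w is l :: w' then ~~ front (flip_letter l) w' && reduced w' else true.

Definition on_pair (x y : V) (l : V * bool) := (l.1 == x) || (l.1 == y).

(* Trace equivalence: by the projection theorem for traces, this is the
   congruence generated by the commutations. *)
Definition teq u w :=
  forall x y, ~~ Gamma x y -> seq.filter (on_pair x y) u = seq.filter (on_pair x y) w.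

Lemma teq_refl w : teq w w. Proof. by []. Qed.
Lemma teq_sym u w : teq u w -> teq w u.
Proof. by move=> e x y /e. Qed.
Lemma teq_trans u1 u2 u3 : teq u1 u2 -> teq u2 u3 -> teq u1 u3.
Proof. by move=> e f x y nG; rewrite e // f. Qed.

Lemma teq_cat u1 u2 w1 w2 : teq u1 u2 -> teq w1 w2 -> teq (u1 ++ w1) (u2 ++ w2).
Proof. by move=> e f x y nG; rewrite !filter_cat e // f. Qed.

Lemma teq_cons l u w : teq u w -> teq (l :: u) (l :: w).
Proof. exact: (@teq_cat [:: l] [:: l]). Qed.

Lemma teq_consI l u w : teq (l :: u) (l :: w) -> teq u w.
Proof. by move=> e x y /e /=; case: ifP => // _ []. Qed.

Lemma teq_swap l m w : comm l m -> teq [:: l, m & w] [:: m, l & w].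
Proof.
move=> lm x y nG /=.
(* A projection keeps at most one of two commuting letters, so it does not see their exchange. *)
suff : ~~ (on_pair x y l && on_pair x y m) by case: on_pair; case: on_pair.
apply/negP => /andP[/orP[]/eqP lE /orP[]/eqP mE]; move: lm nG (comm_neq lm);
  by rewrite /comm lE mE ?eqxx // 1?Gamma_sym => ->.
Qed.

Lemma teq_move l u1 u2 : all (comm l) u1 -> teq (u1 ++ l :: u2) (l :: u1 ++ u2).
Proof.
elim: u1 => [//|m u1 IH] /= /andP[lm lu1]; apply: teq_trans (teq_swap _ _).
  by apply: teq_cons; apply: IH.
by rewrite commC.
Qed.

(** As [Gamma] is irreflexive, the pair x, x is allowed in [teq]; its projection keeps exactly the
    letters on x. *)
Lemma teq_count u w l : teq u w -> count_mem l u = count_mem l w.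
Proof.
move=> /(_ l.1 l.1); rewrite Gamma_irr => /(_ isT) e.
have cm (s : word V) : count_mem l s = count_mem l (seq.filter (on_pair l.1 l.1) s).
  rewrite count_filter; apply: eq_count => m /=; rewrite /on_pair orbb.
  by case: eqP => // ->; rewrite eqxx.
by rewrite cm e -cm.
Qed.

Lemma teq_perm u w : teq u w -> perm_eq u w.
Proof. by move=> e; apply/allP => l _ /=; rewrite (teq_count l e). Qed.

Lemma teq_size u w : teq u w -> size u = size w.
Proof. by move=> /teq_perm/perm_size. Qed.

Lemma front_cat l u w : front l (u ++ w) = front l u || (all (comm l) u && front l w).
Proof.
elim: u => //= m u ->; case: eqP => //= _.
by case: (comm l m).
Qed.

Lemma frontP l w : front l w ->
  exists u1 u2, [/\ w = u1 ++ l :: u2, all (comm l) u1 & rem l w = u1 ++ u2].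
Proof.
elim: w => //= m w IH /orP[/eqP->|/andP[lm /IH[u1 [u2 [-> lu1 remE]]]]].
  by exists [::], w; rewrite eqxx.
exists (m :: u1), u2; split=> //=; first by rewrite lm.
have /negPf-> : m != l by apply: contraTneq lm => ->; rewrite /comm Gamma_irr.
by rewrite remE.
Qed.

Lemma front_rem l w : front l w -> teq w (l :: rem l w).
Proof. by move=> /frontP[u1 [u2 [-> lu1 ->]]]; apply: teq_move. Qed.

(** Expresses [front] through the projections that define [teq], which makes its invariance under
    [teq] immediate. *)
Lemma front_head l w : front l w <->
  forall y, ~~ Gamma l.1 y -> ohead (seq.filter (on_pair l.1 y) w) = Some l.
Proof.
split.
  move=> /frontP[u1 [u2 [-> lu1 _]]] y nG; rewrite filter_cat.
  have -> : seq.filter (on_pair l.1 y) u1 = [::].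
    apply/eqP; rewrite -(negbK (_ == _)) -has_filter -all_predC.
    apply: sub_all lu1 => m lm /=; rewrite /on_pair negb_or eq_sym comm_neq //=.
    by apply: contraNneq nG => <-.
  by rewrite /= /on_pair eqxx.
elim: w => [/(_ l.1)|m w IH h]; first by rewrite Gamma_irr => /(_ isT).
have [->|neq] := eqVneq l m; first by rewrite /= eqxx.
have [lm|nlm] := boolP (comm l m).
  rewrite /= lm orbC IH // => y nG; have := h y nG; rewrite /= {1}/on_pair eq_sym.
  rewrite (negPf (comm_neq lm)) /=; case: eqP => // my.
  by move: nG; rewrite -my -/(comm l m) lm.
by have := h m.1 nlm; rewrite /= {1}/on_pair eqxx orbT => -[/esym/eqP]; rewrite (negPf neq).
Qed.

Lemma teq_front l u w : teq u w -> front l u = front l w.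
Proof.
by move=> e; apply/idP/idP => /front_head h; apply/front_head => y nG;
  rewrite -(h y nG) e.
Qed.

Lemma rem_teq l u w : teq u w -> front l u -> teq (rem l u) (rem l w).
Proof.
move=> e fu; apply: (@teq_consI l); apply: teq_trans (teq_sym (front_rem fu)) _.
by apply: (teq_trans e); apply: front_rem; rewrite -(teq_front _ e).
Qed.

Lemma front_cons_comm l m w : comm l m -> front l (m :: w) = front l w.
Proof.
move=> lm /=; rewrite lm; case: eqP => // e.
by have := comm_neq lm; rewrite e eqxx.
Qed.

Lemma reduced_rem l w : front l w -> reduced w -> reduced (l :: rem l w).
Proof.
elim: w => //= m w IH; have [->|neq /=] := eqVneq l m; first by [].
move=> /andP[lm fl] /andP[nfm rw]; have /andP[nfl' rr] := IH fl rw.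
have lm' : comm (flip_letter l) m by [].
rewrite -/(front (flip_letter l) (m :: rem l w)) (front_cons_comm _ lm') nfl' rr andbT /=.
have e := front_rem fl; move: nfm; rewrite (teq_front _ e) front_cons_comm //.
by rewrite comm_flip commC.
Qed.

Lemma front_flip l w : front l w -> ~~ front (flip_letter l) w.
Proof.
elim: w => //= m w IH /orP[/eqP<-|/andP[lm /IH nf]].
  by rewrite flip_neq /= comm_flip /comm Gamma_irr.
have lm' : comm (flip_letter l) m by [].
by rewrite (negPf nf) andbF orbF; apply: contraTneq (comm_neq lm') => ->; rewrite eqxx.
Qed.

(** Induction on u: its first letter l sits in w behind letters commuting with l. Removing l leaves
    a reduced word by induction, and reinserting it behind those letters creates no cancellation. *)
Lemma reduced_teq u w : teq u w -> reduced u -> reduced w.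
Proof.
elim: u w => [|l u IH] w e; first by have := teq_size e; case: w {e}.
move=> /= /andP[nf ru].
have fw : front l w by rewrite -(teq_front _ e) /= eqxx.
have e' : teq u (rem l w) by apply: (@teq_consI l); apply: teq_trans e (front_rem fw).
have rr := IH _ e' ru.
have [u1 [u2 [wE lu1 remE]]] := frontP fw.
move: nf; rewrite (teq_front _ e') remE => nf; move: rr; rewrite remE wE.
elim: u1 lu1 nf {wE remE} => [|m u1 IH1] /=; first by move=> _ -> ->.
move=> /andP[lm lu1]; have lm' : comm (flip_letter l) m by [].
rewrite -/(front (flip_letter l) (m :: u1 ++ u2)) (front_cons_comm _ lm').
move=> nf /andP[nfm r]; rewrite IH1 // andbT.
have e1 := teq_move u2 lu1.
by rewrite (teq_front _ e1) front_cons_comm // comm_flip commC.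
Qed.

(** A new cancellation has to cross the junction, between a letter that can be moved to the end of u
    and its inverse moved to the front of w. *)
Lemma reduced_cat u w : reduced u -> reduced w ->
  (forall l, front l (rev u) -> ~~ front (flip_letter l) w) -> reduced (u ++ w).
Proof.
elim: u => //= l u IH /andP[nf ru] rw h; rewrite IH //.
  rewrite andbT front_cat negb_or nf /=; apply/nandP.
  have [lu|] := boolP (all _ u); last by left.
  right; apply: h; rewrite rev_cons -cats1 front_cat /= eqxx orTb andbT.
  by rewrite all_rev lu orbT.
by move=> m fm; apply: h; rewrite rev_cons -cats1 front_cat fm.
Qed.

Lemma reduced_catl u w : reduced (u ++ w) -> reduced u.
Proof.
by elim: u => //= l u IH /andP[nf /IH->]; move: nf; rewrite front_cat negb_or => /andP[->].
Qed.

Lemma reduced_catr u w : reduced (u ++ w) -> reduced w.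
Proof. by elim: u => //= l u IH /andP[_ /IH]. Qed.

Lemma reduced_pos (s : seq V) : reduced [seq (x, false) | x <- s].
Proof.
elim: s => //= x s ->; rewrite andbT /flip_letter /=.
by elim: s => //= y s IH; rewrite negb_or negb_and IH orbT andbT xpair_eqE andbF.
Qed.

(** Left multiplication by a letter, on reduced words up to [teq]. By [act_flip] and [act_comm] the
    group acts on reduced traces; this is how inequivalent reduced words are seen to be distinct
    elements. *)
Definition act l w := if front (flip_letter l) w then rem (flip_letter l) w else l :: w.

Definition nf w := foldr act [::] w.

Lemma reduced_act l w : reduced w -> reduced (act l w).
Proof.
rewrite /act; case: ifP => [f rw|nf rw]; last by rewrite /= nf.
by have /andP[] := reduced_rem f rw.
Qed.

Lemma reduced_foldr_act u w : reduced w -> reduced (foldr act w u).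
Proof. by move=> rw; elim: u => //= l u; apply: reduced_act. Qed.

Lemma reduced_nf w : reduced (nf w). Proof. exact: reduced_foldr_act. Qed.

Lemma act_teq l u w : teq u w -> teq (act l u) (act l w).
Proof.
move=> e; rewrite /act -(teq_front _ e); case: ifP => [f|_]; first exact: rem_teq.
exact: teq_cons.
Qed.

Lemma foldr_act_teq r u w : teq u w -> teq (foldr act u r) (foldr act w r).
Proof. by move=> e; elim: r => //= l r; apply: act_teq. Qed.

Lemma act_flip l w : reduced w -> teq (act l (act (flip_letter l) w)) w.
Proof.
move=> rw; rewrite {2}/act flip_letterK; case: ifP => [f|nf].
  have /andP[/negPf nf _] := reduced_rem f rw.
  by rewrite /act nf; apply/teq_sym/front_rem.
by rewrite /act /= eqxx.
Qed.

Lemma act_comm l m w : comm l m -> teq (act l (act m w)) (act m (act l w)).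
Proof.
move=> lm; have ml : comm m l by rewrite commC.
(* Acting by a letter that commutes with a does not affect whether the inverse of a can be moved to
   the front. *)
have front_act (a b : V * bool) : comm a b ->
    front (flip_letter a) (act b w) = front (flip_letter a) w.
  move=> ab; rewrite /act; case: ifP => [fb|_]; last by rewrite front_cons_comm.
  by rewrite [RHS](teq_front _ (front_rem fb)) front_cons_comm.
rewrite {1}/act front_act // [in X in teq _ X]/act front_act //.
rewrite /act; case: ifP => [fl|nfl]; case: ifP => [fm|nfm].
- have rem2 (a b : V * bool) : comm a b -> front a w -> front b w ->
      teq w [:: a, b & rem b (rem a w)].
    move=> ab fa fb; have ea := front_rem fa; apply: (teq_trans ea).
    apply/teq_cons/front_rem.
    by move: fb; rewrite (teq_front _ ea) front_cons_comm // commC.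
  apply: (@teq_consI (flip_letter l)); apply: (@teq_consI (flip_letter m)).
  apply: teq_trans (teq_sym (rem2 _ _ _ fm fl)) _ => //.
  by apply: teq_trans (rem2 _ _ _ fl fm) (teq_swap _ _).
- by rewrite /=; case: eqP => [mE|//]; have := comm_neq lm; rewrite mE eqxx.
- by rewrite /=; case: eqP => [lE|//]; have := comm_neq ml; rewrite lE eqxx.
- exact: teq_swap.
Qed.

End Traces.

(** * Word length in a presented group *)

Section PresentedWords.
Variables (X : finType) (Rel : set (word X)).
Implicit Types (u w : word X) (g h : presented Rel).
Local Open Scope group_scope.

Definition elt w : presented Rel := \pi_(presented Rel)%qT w.

Lemma elt_nil : elt [::] = 1. Proof. by []. Qed.

Lemma elt_cat u w : elt (u ++ w) = elt u * elt w.
Proof. exact/esym/presented_mulE. Qed.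

Lemma elt_flip l : elt [:: flip_letter l] = (elt [:: l])^-1.
Proof. exact/esym/presented_invE. Qed.

Lemma elt_eqP u w : elt u = elt w <-> presentation_eq Rel u w.
Proof. exact: presented_piP. Qed.

Lemma word_length_elt w : (word_length (elt w) <= size w)%N.
Proof.
by rewrite /word_length; case: ex_minnP => n _; apply; apply/asboolP; exists w.
Qed.

Lemma geodesic_word g : exists w, elt w = g /\ size w = word_length g.
Proof.
by rewrite /word_length; case: ex_minnP => n /asboolP[w [sw wE]] _; exists w.
Qed.

Lemma word_lengthM g h : (word_length (g * h)%g <= word_length g + word_length h)%N.
Proof.
have [u [<- <-]] := geodesic_word g; have [w [<- <-]] := geodesic_word h.
by rewrite -elt_cat -size_cat word_length_elt.
Qed.

(** By the triangle inequality, a shorter word for the factor u would shorten the whole word. *)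
Lemma geodesic_infix a u b :
  size (a ++ u ++ b) = word_length (elt (a ++ u ++ b)) ->
  size u = word_length (elt u).
Proof.
rewrite !elt_cat => e; apply/eqP; rewrite eqn_leq word_length_elt andbT.
have := word_lengthM (elt a) (elt u * elt b).
have := word_lengthM (elt u) (elt b).
have := word_length_elt a; have := word_length_elt b.
by move: e; rewrite !size_cat; lia.
Qed.

End PresentedWords.
Arguments elt {X} Rel w.

(** * The word problem in a RAAG: geodesic words are the reduced ones *)

Section RaagWords.
Variables (V : finType) (Gamma : rel V).
Hypothesis Gamma_sym : symmetric Gamma.
Hypothesis Gamma_irr : irreflexive Gamma.
Implicit Types (l m : V * bool) (u w : word V).
Local Open Scope group_scope.

Local Notation RG := (raag_relators Gamma).

Lemma commute_letters l m : comm Gamma l m -> commute (elt RG [:: l]) (elt RG [:: m]).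
Proof.
have flipE (x : V) : (x, true) = flip_letter (x, false) by [].
have pos x y : Gamma x y -> commute (elt RG [:: (x, false)]) (elt RG [:: (y, false)]).
  move=> xy; pose r := [:: (x, false); (y, false); (x, true); (y, true)].
  have : elt RG r = 1.
    by apply/elt_eqP/(@pres_relator _ RG [::] [::] r); exists (x, y).
  rewrite /r.
  rewrite -(cat1s (x, false)) -(cat1s (y, false)) -(cat1s (x, true)) !elt_cat.
  rewrite !flipE !elt_flip => e.
  apply: (@mulIg _ (elt RG [:: (x, false)])^-1); rewrite mulgK.
  by apply: (@mulIg _ (elt RG [:: (y, false)])^-1); rewrite mulgV -[RHS]e !mulgA.
case: l m => x [] [y []] /pos xy; rewrite ?flipE ?elt_flip //.
- exact/commuteV/commute_sym/commuteV/commute_sym.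
- exact/commute_sym/commuteV/commute_sym.
- exact/commuteV.
Qed.

Lemma elt_move l u : all (comm Gamma l) u -> commute (elt RG [:: l]) (elt RG u).
Proof.
elim: u => [_|m u IH /= /andP[/commute_letters lm /IH lu]]; first exact: commute1.
by rewrite -(cat1s m u) elt_cat; apply: commuteM.
Qed.

Lemma elt_teq u w : teq Gamma u w -> elt RG u = elt RG w.
Proof.
elim: u w => [|l u IH] w e; first by have := teq_size Gamma_irr e; case: w {e}.
have fw : front Gamma l w by rewrite -(teq_front Gamma_irr _ e) /= eqxx.
have e' : teq Gamma u (rem l w).
  exact: (@teq_consI _ _ l) (teq_trans e (front_rem Gamma_sym Gamma_irr fw)).
have [u1 [u2 [wE /elt_move lu1 remE]]] := frontP Gamma_irr fw.
rewrite -(cat1s l u) elt_cat (IH _ e') remE wE !elt_cat -(cat1s l u2) elt_cat.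
by rewrite !mulgA lu1.
Qed.

(** [nf] is the image of the empty word under the action of the letters, so it is enough that
    relations act trivially: free cancellation by [act_flip], a commutator by first exchanging its
    two middle letters. *)
Lemma nf_pres u w : presentation_eq RG u w -> teq Gamma (nf Gamma u) (nf Gamma w).
Proof.
rewrite /nf; elim=> {u w} [w|u w _|u1 u2 u3 _ IH1 _ IH2|u w l|u w r].
- exact: teq_refl.
- exact: teq_sym.
- exact: teq_trans IH2.
- rewrite (foldr_cat _ _ u) [X in teq _ _ X]foldr_cat; apply: foldr_act_teq => //.
  exact/act_flip/reduced_nf.
- case=> -[x y] /= xy <-; rewrite (foldr_cat _ _ u) [X in teq _ _ X]foldr_cat.
  apply: foldr_act_teq => //; rewrite foldr_cat /=.
  have := reduced_nf Gamma_sym Gamma_irr w; rewrite /nf; set z := foldr _ _ w => rz.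
  have aE := act_flip Gamma_sym Gamma_irr.
  apply: teq_trans (aE (y, false) _ rz); rewrite /flip_letter /=.
  set z' := act _ _ z.
  have rz' : reduced Gamma z' by apply: reduced_act.
  apply: (@teq_trans _ _ _
    (act Gamma (x, false) (act Gamma (x, true) (act Gamma (y, false) z')))).
    by apply: act_teq => //; apply: act_comm => //; rewrite /comm /= Gamma_sym.
  exact: (aE (x, false) (act Gamma (y, false) z') (reduced_act _ _ _ rz')).
Qed.

Lemma elt_act l w : elt RG (act Gamma l w) = elt RG (l :: w).
Proof.
rewrite /act; case: ifP => // f; have := elt_teq (front_rem Gamma_sym Gamma_irr f).
move=> e; rewrite -(cat1s l w) elt_cat e -(cat1s (flip_letter l)) elt_cat elt_flip.
by rewrite mulVKg.
Qed.

Lemma elt_nf w : elt RG (nf Gamma w) = elt RG w.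
Proof.
by elim: w => //= l w IH; rewrite elt_act -cat1s elt_cat IH -elt_cat.
Qed.

Lemma size_act l w : (size (act Gamma l w) <= (size w).+1)%N.
Proof.
rewrite /act; case: ifP => // /(frontP Gamma_irr)[u1 [u2 [-> _ ->]]].
by rewrite !size_cat /=; lia.
Qed.

Lemma size_nf w : (size (nf Gamma w) <= size w)%N.
Proof. by elim: w => //= l w IH; apply: leq_trans (size_act l _) _. Qed.

Lemma nf_reduced w : reduced Gamma w -> nf Gamma w = w.
Proof. by elim: w => //= l w IH /andP[/negPf nf /IH->]; rewrite /act nf. Qed.

(** Each letter lengthens [nf] by at most one, so a single cancellation would make the size drop for
    good. *)
Lemma reduced_nfP w : size (nf Gamma w) = size w -> reduced Gamma w.
Proof.
elim: w => //= l w IH; rewrite /act; case: ifP => [f|nf] /=.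
  have [u1 [u2 [nfE _ ->]]] := frontP Gamma_irr f.
  by have := size_nf w; rewrite nfE !size_cat /=; lia.
by move=> [e]; have rw := IH e; move: nf; rewrite nf_reduced // => ->.
Qed.

(** [nf] fixes reduced words, and up to [teq] it depends on the element only. *)
Lemma reduced_teq_elt u w : reduced Gamma u -> reduced Gamma w ->
  elt RG u = elt RG w -> teq Gamma u w.
Proof. by move=> ru rw /elt_eqP/nf_pres; rewrite !nf_reduced. Qed.

Lemma word_length_nf w : word_length (elt RG w) = size (nf Gamma w).
Proof.
have [u [uE su]] := geodesic_word (elt RG w).
have /elt_eqP/nf_pres/(teq_size Gamma_irr) e := uE.
have := word_length_elt RG (nf Gamma w); rewrite elt_nf.
by have := size_nf u; lia.
Qed.

Lemma reducedP w : reduced Gamma w <-> size w = word_length (elt RG w).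
Proof.
rewrite word_length_nf; split=> [/nf_reduced->//|e]; exact: reduced_nfP.
Qed.

Definition geo (g : raag Gamma) : word V := nf Gamma (repr g).

Lemma geoK g : elt RG (geo g) = g.
Proof. by rewrite elt_nf /elt reprK. Qed.

Lemma reduced_geo g : reduced Gamma (geo g).
Proof. exact: reduced_nf. Qed.

Lemma size_geo g : size (geo g) = word_length g.
Proof. by rewrite -{2}(geoK g); apply/reducedP/reduced_geo. Qed.

Lemma word_length_reduced w : reduced Gamma w -> word_length (elt RG w) = size w.
Proof. by move=> /reducedP. Qed.

End RaagWords.

Lemma rev_nseq (T : Type) k (x : T) : rev (nseq k x) = nseq k x.
Proof.
by apply: (@eq_from_nth _ x) => [|i]; rewrite size_rev // size_nseq => ik;
  rewrite nth_rev ?size_nseq // !nth_nseq !if_same.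
Qed.

(** * Points through which every geodesic passes *)

Section Bottlenecks.
Variables (V : finType) (Gamma : rel V).
Hypothesis Gamma_sym : symmetric Gamma.
Hypothesis Gamma_irr : irreflexive Gamma.
Implicit Types (l m : V * bool) (u w : word V).

Lemma teq_catI u1 u2 w1 w2 : teq Gamma u1 u2 ->
  teq Gamma (u1 ++ w1) (u2 ++ w2) -> teq Gamma w1 w2.
Proof.
move=> e f x y nG; move/eqP: (f x y nG); rewrite !filter_cat e //.
by rewrite eqseq_cat // => /andP[_ /eqP].
Qed.

(* Geometrically, when AB is reduced, all geodesics from 1 to AB pass through A. *)
Lemma bottleneck A B w :
  (forall a b, front Gamma a (rev A) -> front Gamma b B -> ~~ comm Gamma a b) ->
  teq Gamma (A ++ B) w -> teq Gamma A (take (size A) w).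
Proof.
elim: A w => [|l A IH] w h e; first by rewrite take0.
have fw : front Gamma l w by rewrite -(teq_front Gamma_irr _ e) /= eqxx.
have [C [D [wE lC remE]]] := frontP Gamma_irr fw.
have e' : teq Gamma (A ++ B) (C ++ D).
  rewrite -remE; apply: (@teq_consI _ _ l).
  exact: teq_trans e (front_rem Gamma_sym Gamma_irr fw).
have hA a b : front Gamma a (rev A) -> front Gamma b B -> ~~ comm Gamma a b.
  by move=> fa; apply: h; rewrite rev_cons -cats1 front_cat fa.
have eA := IH _ hA e'; rewrite wE /=.
(* C is the part of w before its first l. If C is no longer than A, putting l back after C yields
   the prefix of length size A + 1. Otherwise A is equivalent to a prefix of C, so l commutes with A
   and with the next letter c of C; then l is final in l :: A and c is initial in B, against h. *)
have [CA|AC] := leqP (size C) (size A).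
  rewrite take_cat ltnNge (leqW CA) /= subSn //=.
  apply: teq_trans (teq_cons l eA) _; apply: teq_sym.
  rewrite take_cat ltnNge CA /=; exact: teq_move.
have CE : take (size A) (C ++ D) = take (size A) C.
  by rewrite take_cat AC.
rewrite CE in eA; case CD : (drop (size A) C) => [|c C2].
  by move: AC; rewrite -subn_gt0 -size_drop CD.
have lA : all (comm Gamma l) A.
  rewrite (perm_all _ (teq_perm Gamma_irr eA)).
  by move: lC; rewrite -{1}(cat_take_drop (size A) C) all_cat => /andP[].
have fB : front Gamma c B.
  have eB : teq Gamma B (c :: C2 ++ D).
    by apply: (teq_catI eA); rewrite -cat_cons -CD catA cat_take_drop.
  by rewrite (teq_front Gamma_irr _ eB) /= eqxx.
have := h l c; rewrite rev_cons -cats1 front_cat /= eqxx orTb andbT all_rev lA orbT.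
move=> /(_ isT fB) /negP[].
by move: lC; rewrite -{1}(cat_take_drop (size A) C) CD all_cat /= => /and3P[].
Qed.

End Bottlenecks.

(** * Connectors: gluing two words around a power of v *)

Section Connectors.
Variables (V : finType) (Gamma : rel V).
Hypothesis Gamma_sym : symmetric Gamma.
Hypothesis Gamma_irr : irreflexive Gamma.
Implicit Types (l m : V * bool) (u w : word V).
Local Notation RG := (raag_relators Gamma).
Local Notation nc := (fun x y => ~~ Gamma x y).

Definition pos (s : seq V) : word V := [seq (x, false) | x <- s].

Lemma pos_cat s1 s2 : pos (s1 ++ s2) = pos s1 ++ pos s2.
Proof. exact: map_cat. Qed.

Lemma rev_pos s : rev (pos s) = pos (rev s).
Proof. by rewrite /pos map_rev. Qed.

(** A letter moved to the front past a commutes with a, so it is not the next letter of the walk,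
    and it has to pass that one too; by induction it passes the entire walk. *)
Lemma front_walk_or a q X l : path nc a.1 q ->
  front Gamma l (a :: pos q ++ X) -> l = a \/ all (comm Gamma l) (a :: pos q).
Proof.
elim: q a => [|y q IH] a /=; first by move=> _ /orP[/eqP|/andP[->]]; [left|right].
move=> /andP[nay pq] /orP[/eqP->|/andP[la fl]]; first by left.
case: (IH (y, false) pq fl) => [lE|/= ->]; last by right; rewrite la.
by move: la nay; rewrite /comm lE Gamma_sym => ->.
Qed.

(** A letter commuting with the whole walk would commute with its own vertex, which the walk
    visits. *)
Lemma front_walk a q X l : path nc a.1 q -> (forall x, x \in a.1 :: q) ->
  front Gamma l (a :: pos q ++ X) = (l == a).
Proof.
move=> pq cov; apply/idP/eqP => [f|->]; last by rewrite /= eqxx.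
case: (front_walk_or pq f) => // /= /andP[la lq].
have := cov l.1; rewrite inE => /orP[/eqP lE|lq'].
  by move: la; rewrite /comm lE Gamma_irr.
have /(allP lq) : (l.1, false) \in pos q by apply/mapP; exists l.1.
by rewrite /comm Gamma_irr.
Qed.

Variables (v z : V) (p : seq V).
(** The sign s is left free so that it can be chosen to prevent cancellation with the adjacent
    word. *)
Definition half s : word V := (z, s) :: pos p.

Definition conn k s s' w1 w2 : word V :=
  w1 ++ half s ++ nseq k (v, false) ++ rev (half s') ++ w2.

Lemma rev_half s : rev (half s) = pos (rev p) ++ [:: (z, s)].
Proof. by rewrite /half rev_cons rev_pos -cats1. Qed.

Lemma size_conn k s s' w1 w2 :
  size (conn k s s' w1 w2) = (size w1 + size w2 + k + (size p).+1.*2)%N.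
Proof. by rewrite !size_cat size_rev size_nseq /= size_map; lia. Qed.

(* p is a closed walk based at z in the opposite graph, visiting every vertex. *)
Hypothesis zp : path nc z p.
Hypothesis zlast : last z p = z.
Hypothesis pcov : forall x, x \in p.
Hypothesis zhead : head z p != z.
Hypothesis zv : ~~ Gamma z v.
Hypothesis znv : z != v.

Lemma pE : exists y q, [/\ p = y :: q, y != z, ~~ Gamma z y & path nc y q].
Proof.
case: p zp zhead (pcov z) => //= y q /andP[ny pq] yz _.
by exists y, q.
Qed.

(** The walk is closed, so its reversal is again a covering walk starting at z. *)
Lemma rev_pE : exists q, [/\ rev p = z :: q, path nc z q & forall x, x \in z :: q].
Proof.
case/lastP: p zp zlast pcov (pcov z) => // q x; rewrite last_rcons => pq xz cov _.
rewrite xz in pq cov *.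
exists (rev q); split; first by rewrite rev_rcons.
  have : path nc (last z (rcons q z)) (rev (belast z (rcons q z))).
    by rewrite rev_path; apply: sub_path pq => a b /=; rewrite Gamma_sym.
  by rewrite last_rcons belast_rcons rev_cons rcons_path => /andP[].
by move=> x'; have := cov x'; rewrite -mem_rev rev_rcons.
Qed.

Lemma path_nseq k y q : path nc y (nseq k y ++ q) = path nc y q.
Proof. by elim: k => //= k ->; rewrite Gamma_irr. Qed.

Lemma front_half s X l : front Gamma l (half s ++ X) = (l == (z, s)).
Proof. by apply: front_walk => // x; rewrite inE pcov orbT. Qed.

Lemma front_pos_p X l : front Gamma l (pos p ++ X) -> l = (head z p, false).
Proof.
have [y [q [pyq _ _ yq]]] := pE; rewrite pyq => f; apply/eqP; move: f.
by rewrite (@front_walk (y, false)) // => x; have := pcov x; rewrite pyq.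
Qed.

Lemma front_rev_half s X l : front Gamma l (rev (half s) ++ X) -> l = (z, false).
Proof.
have [q [qE pq cov]] := rev_pE; rewrite rev_half qE -catA => f; apply/eqP; move: f.
by rewrite (@front_walk (z, false)).
Qed.

(** Repeating v is a legal step, [Gamma] being irreflexive, and v does not commute with z; so the
    run followed by the reversed walk is again a covering walk. *)
Lemma front_run k s X l :
  front Gamma l (nseq k.+1 (v, false) ++ rev (half s) ++ X) -> l = (v, false).
Proof.
have [q [qE pq cov]] := rev_pE.
have -> : nseq k.+1 (v, false) ++ rev (half s) ++ X =
    (v, false) :: pos (nseq k v ++ z :: q) ++ (z, s) :: X.
  by rewrite rev_half qE pos_cat /pos map_nseq /= -!catA.
move=> f; apply/eqP; move: f; rewrite front_walk //=; last first.
  by move=> x; rewrite inE mem_cat cov !orbT.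
by rewrite path_nseq /= Gamma_sym zv.
Qed.

(** Between the two extreme letters z the word is positive, hence reduced. These letters do not
    cancel into it, since next to them stands a different vertex not commuting with z; the signs
    handle the junctions with w1 and w2. *)
Lemma reduced_conn k s s' w1 w2 : reduced Gamma w1 -> reduced Gamma w2 ->
  ~~ front Gamma (flip_letter (z, s)) (rev w1) ->
  ~~ front Gamma (flip_letter (z, s')) w2 ->
  reduced Gamma (conn k s s' w1 w2).
Proof.
move=> r1 r2 f1 f2; have [y [q [pyq yz nzy yq]]] := pE.
apply: reduced_cat => //; last first.
  move=> l fl; rewrite front_half; apply/eqP => lE.
  by move: f1; rewrite -lE flip_letterK fl.
have -> : half s ++ nseq k (v, false) ++ rev (half s') ++ w2 =
    (z, s) :: pos (p ++ nseq k v ++ rev p) ++ (z, s') :: w2.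
  by rewrite rev_half /half !pos_cat /pos map_nseq /= -!catA.
rewrite /= {1}pyq /= negb_or negb_and nzy /flip_letter /= xpair_eqE eq_sym (negPf yz) /=.
apply: reduced_cat => //=; [exact: reduced_pos| by rewrite f2 |].
move=> l; rewrite rev_pos !rev_cat revK rev_nseq -catA pos_cat => /front_pos_p ->.
rewrite pyq /= negb_or negb_and xpair_eqE (negPf yz) /= /comm /=.
by rewrite Gamma_sym nzy.
Qed.

(** A letter and its inverse cannot both be moved to the front of the same word. *)
Lemma conn_signs w1 w2 : exists ss : bool * bool,
  ~~ front Gamma (flip_letter (z, ss.1)) (rev w1) &&
  ~~ front Gamma (flip_letter (z, ss.2)) w2.
Proof.
have sgn w : exists s, ~~ front Gamma (flip_letter (z, s)) w.
  have [/front_flip f|nf] := boolP (front Gamma (z, true) w); last by exists false.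
  by exists true; apply: f.
have [s fs] := sgn (rev w1); have [s' fs'] := sgn w2.
by exists (s, s'); rewrite fs fs'.
Qed.

(** At each end of the run, the only final letter on the left and the only initial letter on the
    right are z and v in some order. They do not commute, so [bottleneck] applies. *)
Lemma conn_passes k s s' w1 w2 u : reduced Gamma u ->
  reduced Gamma (conn k.+1 s s' w1 w2) ->
  elt RG u = elt RG (conn k.+1 s s' w1 w2) ->
  elt RG (take (size w1 + (size p).+1) u) = elt RG (w1 ++ half s) /\
  elt RG (take (size w1 + (size p).+1 + k.+1) u) =
    elt RG (w1 ++ half s ++ nseq k.+1 (v, false)).
Proof.
move=> ru rc /esym/(reduced_teq_elt Gamma_sym Gamma_irr rc ru) e; split.
  have -> : (size w1 + (size p).+1)%N = size (w1 ++ half s).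
    by rewrite size_cat /= size_map.
  apply/esym/elt_teq => //.
  apply: (bottleneck Gamma_sym Gamma_irr) (_ : teq _ (_ ++ _) u); last first.
    by rewrite /conn catA in e; apply: e.
  move=> a b; rewrite rev_cat => /front_rev_half -> /front_run ->.
  by rewrite /comm.
have -> : (size w1 + (size p).+1 + k.+1)%N = size (w1 ++ half s ++ nseq k.+1 (v, false)).
  by rewrite !size_cat size_nseq /= size_map addnA.
apply/esym/elt_teq => //.
apply: (bottleneck Gamma_sym Gamma_irr) (_ : teq _ (_ ++ _) u); last first.
  by rewrite /conn (catA (half s)) catA in e; apply: e.
move=> a b; rewrite !rev_cat rev_nseq -!catA => /front_run -> /front_rev_half ->.
by rewrite /comm /= Gamma_sym.
Qed.

Lemma conn_inj k s s' w1 w2 u1 u2 :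
  reduced Gamma (conn k.+1 s s' w1 w2) -> reduced Gamma (conn k.+1 s s' u1 u2) ->
  elt RG (conn k.+1 s s' w1 w2) = elt RG (conn k.+1 s s' u1 u2) ->
  size w1 = size u1 -> elt RG w1 = elt RG u1 /\ elt RG w2 = elt RG u2.
Proof.
move=> rw ru e s1; have [e1 _] := conn_passes rw ru e.
have e1' : elt RG w1 = elt RG u1.
  move: e1; rewrite -s1 {1}/conn catA take_size_cat; last by rewrite size_cat /= size_map.
  by rewrite !elt_cat => /mulIg.
split=> //; move: e; rewrite /conn !elt_cat e1'.
by do 4!move/mulgI.
Qed.

(** The run can be located. Were a1 shorter than b1, the word built from b1 would also read v^(k+1)
    from the position dictated by a1. That block would lie inside b1, or cover the z opening the
    connector, or cover the z closing its first half; the last case uses size p <= k. *)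
Lemma conn_inj_avoid k s s' w1 w2 u1 u2 : (size p <= k)%N ->
  ~~ infix (nseq k.+1 (v, false)) w1 -> ~~ infix (nseq k.+1 (v, false)) u1 ->
  reduced Gamma (conn k.+1 s s' w1 w2) -> reduced Gamma (conn k.+1 s s' u1 u2) ->
  elt RG (conn k.+1 s s' w1 w2) = elt RG (conn k.+1 s s' u1 u2) ->
  size w1 = size u1.
Proof.
move=> pk.
suff lt (a1 a2 b1 b2 : word V) : ~~ infix (nseq k.+1 (v, false)) b1 ->
    reduced Gamma (conn k.+1 s s' a1 a2) -> reduced Gamma (conn k.+1 s s' b1 b2) ->
    elt RG (conn k.+1 s s' a1 a2) = elt RG (conn k.+1 s s' b1 b2) ->
    ~~ (size a1 < size b1)%N.
  move=> nw nu rw ru e; apply/eqP; rewrite eqn_leq leqNgt (lt _ _ _ _ nw ru rw) //.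
  by rewrite leqNgt (lt _ _ _ _ nu rw ru).
move=> nb ra rb e; apply/negP => ab.
have [e1 e2] := conn_passes rb ra (esym e); set U := conn _ _ _ b1 b2 in rb e1 e2.
set t := (size a1 + (size p).+1)%N in e1 e2.
(* As a factor of a reduced word this segment is reduced; it represents v^(k+1), so it is that
   word. *)
have UE : take k.+1 (drop t U) = nseq k.+1 (v, false).
  have rU : reduced Gamma (take k.+1 (drop t U)).
    apply: (@reduced_catl _ _ _ (drop k.+1 (drop t U))); rewrite cat_take_drop.
    by apply: (@reduced_catr _ _ (take t U)); rewrite cat_take_drop.
  have rn : reduced Gamma (nseq k.+1 (v, false)).
    by have := reduced_pos Gamma (nseq k.+1 v); rewrite map_nseq.
  have /(reduced_teq_elt Gamma_sym Gamma_irr rU rn)/(teq_perm Gamma_irr) pe :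
      elt RG (take k.+1 (drop t U)) = elt RG (nseq k.+1 (v, false)).
    move: e2; rewrite takeD elt_cat e1 catA (elt_cat _ (a1 ++ half s)).
    exact: mulgI.
  have /all_pred1P -> : all (pred1 (v, false)) (take k.+1 (drop t U)).
    by rewrite (perm_all _ pe) all_nseq /= eqxx.
  by rewrite (perm_size pe) size_nseq.
have vE i : (t <= i < t + k.+1)%N -> (nth (z, s) U i).1 = v.
  move=> /andP[ti ik]; rewrite -(subnKC ti) -nth_drop -(@nth_take k.+1) ?UE.
    by rewrite nth_nseq ifT //; lia.
  lia.
have UEb : U = b1 ++ half s ++ (nseq k.+1 (v, false) ++ rev (half s') ++ b2) by [].
have [tb|bt] := leqP (t + k.+1) (size b1).
  move: nb; rewrite -UE UEb drop_cat ifT; last by lia.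
  have kb : (k.+1 <= size (drop t b1))%N by rewrite size_drop; lia.
  rewrite takel_cat //.
  move=> /negP[]; apply/infixP; exists (take t b1), (drop k.+1 (drop t b1)).
  by rewrite !cat_take_drop.
have [tb|b1t] := leqP t (size b1).
  have := vE (size b1); rewrite tb bt => /(_ isT).
  by rewrite UEb nth_cat ltnn subnn /= => /eqP; rewrite (negPf znv).
have := vE (size b1 + size p)%N; rewrite UEb nth_cat ifN; last by lia.
rewrite addKn nth_cat /= size_map ltnS leqnn.
have -> : nth (z, s) (half s) (size p) = last (z, s) (pos p).
  by rewrite (last_nth (z, s)) /pos size_map.
have [y [q [pyq _ _ _]]] := pE.
have -> : (last (z, s) (pos p)).1 = z.
  by move: zlast; rewrite pyq /= /pos last_map.
move=> zve; move: znv; rewrite zve ?eqxx // /t.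
by move: b1t bt ab pk; rewrite /t; lia.
Qed.

End Connectors.

(** * Covering closed walks in the opposite graph *)

Section Walks.
Variables (V : finType) (Gamma : rel V).
Hypothesis Gamma_sym : symmetric Gamma.
Hypothesis irred : raag_irreducible Gamma.
Hypothesis nonelem : raag_non_elementary V.
Local Notation opp := (opposite_graph Gamma).

Lemma covering_walk (s : seq V) (x y : V) :
  exists q, [/\ path opp x q, last x q = y & {subset s <= x :: q}].
Proof.
elim: s x => [|a s IH] x.
  by have /connectP[q pq ->] := irred x y; exists q.
have /connectP[q1 p1 aE] := irred x a; have [q2 [p2 l2 sub]] := IH a.
exists (q1 ++ q2); split; first by rewrite cat_path p1 -aE.
  by rewrite last_cat -aE.
move=> b; rewrite -cat_cons mem_cat inE => /orP[/eqP->|/sub].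
  by rewrite aE mem_last.
rewrite inE => /orP[/eqP->|->]; last by rewrite orbT.
by rewrite aE mem_last.
Qed.

(** z is the first step of a path from v to another vertex, so it does not commute with v; p is
    nonempty because it has to visit v, which differs from z. *)
Lemma covering_loop (v : V) : exists z p,
  [/\ path (fun x y => ~~ Gamma x y) z p, last z p = z, forall x, x \in p,
     head z p != z & ~~ Gamma z v /\ z != v].
Proof.
have [u uv] : exists u, u != v.
  have /card_gt0P[u] : (0 < #|predC1 v|)%N.
    by have := cardC1 v; move: nonelem; rewrite /raag_non_elementary; lia.
  by rewrite inE => uv; exists u.
have /connectP[[|z q] /=] := irred v u; first by move=> _ e; rewrite e eqxx in uv.
move=> /andP[/andP[vz nvz] _] _.
have [p [pp lp sub]] := covering_walk (enum V) z z.
have pn : p != [::].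
  apply/eqP => pE; have := sub v; rewrite mem_enum pE !inE => /(_ isT)/eqP vE.
  by rewrite vE eqxx in vz.
exists z, p; split=> //.
- by apply: sub_path pp => a b /andP[].
- move=> x; have := sub x; rewrite mem_enum inE => /(_ isT) /orP[/eqP->|//].
  by case: p pn lp {pp sub} => //= a p _ <-; apply: mem_last.
- by case: p pn pp {lp sub} => //= a p _ /andP[/andP[za _] _]; rewrite eq_sym.
- by rewrite Gamma_sym eq_sym.
Qed.

End Walks.

(** * Powers of a generator, and paths in the Cayley graph *)

Section CayleyPaths.
Variables (X : finType) (Rel : set (word X)).
Implicit Types (w : word X) (g h : presented Rel).
Local Open Scope group_scope.

Lemma elt_nseqD k l (c : X * bool) :
  elt Rel (nseq (k + l) c) = elt Rel (nseq k c) * elt Rel (nseq l c).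
Proof. by rewrite -elt_cat nseqD. Qed.

Lemma elt_nseqV k (v : X) s :
  (elt Rel (nseq k (v, s)))^-1 = elt Rel (nseq k (v, ~~ s)).
Proof.
have -> : nseq k (v, ~~ s) = inv_word (nseq k (v, s)).
  by rewrite /inv_word map_nseq rev_nseq.
exact: presented_invE.
Qed.

Lemma elt_nseq_mul k l (v : X) s s' : exists j r,
  elt Rel (nseq k (v, s)) * elt Rel (nseq l (v, s')) = elt Rel (nseq j (v, r)).
Proof.
have [<-|ss'] := eqVneq s s'; first by exists (k + l)%N, s; rewrite elt_nseqD.
have -> : s' = ~~ s by case: s s' ss' => [] [].
rewrite -elt_nseqV; have [lk|kl] := leqP l k.
  by exists (k - l)%N, s; rewrite -{1}(subnK lk) elt_nseqD mulgK.
exists (l - k)%N, (~~ s); rewrite -{1}(subnKC (ltnW kl)) addnC elt_nseqD -elt_nseqV.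
by rewrite -[in LHS](subnKC (ltnW kl)) addKn invgM mulVKg.
Qed.

Lemma cyclic_subgroupP (v : X) h :
  subgroup_generated [set gen Rel v] h <-> exists k s, h = elt Rel (nseq k (v, s)).
Proof.
split.
  pose C := [set x : presented Rel | exists k s, x = elt Rel (nseq k (v, s))].
  apply: (@smallest_sub _ _ _ C) => [|_ ->]; last by exists 1%N, false.
  split; first by apply/mem_set; exists 0%N, false.
  move=> x y /set_mem[k [s ->]] /set_mem[l [s' ->]]; apply/mem_set.
  by rewrite elt_nseqV; apply: elt_nseq_mul.
case=> k [s ->] M [[M1 MV] Mv].
have Mg : gen Rel v \in M by apply/mem_set/Mv.
have MI x : x \in M -> x^-1 \in M by move=> xM; rewrite -[x^-1]mul1g MV.
have Ml : elt Rel [:: (v, s)] \in M.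
  by case: s; rewrite // -[(v, true)]/(flip_letter (v, false)) elt_flip MI.
apply: set_mem; elim: k => [|k IH] //.
rewrite -[nseq _ _]/([:: (v, s)] ++ nseq k (v, s)) elt_cat -[elt Rel (nseq k _)]invgK.
exact/MV/MI.
Qed.

Lemma word_lengthV g : word_length g^-1 = word_length g.
Proof.
have le h : (word_length h^-1 <= word_length h)%N.
  have [w [<- <-]] := geodesic_word h.
  have -> : (elt Rel w)^-1 = elt Rel (inv_word w) by exact: presented_invE.
  by apply: leq_trans (word_length_elt _ _) _; rewrite size_rev size_map.
by apply/eqP; rewrite eqn_leq le -{1}(invgK g) le.
Qed.

(** The starting vertex g is left out, in accordance with [geodesic]. *)
Definition trace_path g w := scanl (fun h l => h * elt Rel [:: l]) g w.

Lemma nth_trace_path g w i : (i <= size w)%N ->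
  nth g (g :: trace_path g w) i = g * elt Rel (take i w).
Proof.
elim: w g i => [|l w IH] g [|i] iw; rewrite ?take0 ?elt_nil ?mulg1 //.
rewrite -[take _ _]/([:: l] ++ take i w) elt_cat mulgA -IH //=.
by apply: set_nth_default; rewrite /= size_scanl.
Qed.

Lemma cayley_trace_path g w : path (@cayley X Rel) g (trace_path g w).
Proof.
elim: w g => //= -[x b] w IH g; rewrite IH andbT; apply/asboolP; exists x.
case: b; [right|left] => //.
by rewrite -[(x, true)]/(flip_letter (x, false)) elt_flip.
Qed.

Lemma geodesic_trace_path w : size w = word_length (elt Rel w) ->
  geodesic 1 (elt Rel w) (trace_path 1 w).
Proof.
move=> sw; split; [exact: cayley_trace_path| |].
  rewrite (last_nth 1) nth_trace_path size_scanl ?take_size ?mul1g //.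
by rewrite size_scanl /word_dist invg1 mul1g.
Qed.

Lemma path_trace g p : path (@cayley X Rel) g p ->
  exists2 w, p = trace_path g w & size w = size p.
Proof.
elim: p g => [|h p IH] g /=; first by exists [::].
move=> /andP[/asboolP[x hE] /IH[w -> ws]].
have [l lE] : exists l, h = g * elt Rel [:: l].
  case: hE => ->; [by exists (x, false)|exists (flip_letter (x, false))].
  by rewrite elt_flip.
by exists (l :: w); rewrite /= -?lE // ws.
Qed.

End CayleyPaths.

(** * Excursion in a vertex group in terms of runs in geodesic words *)

Section Excursion.
Variables (R : realType) (V : finType) (Gamma : rel V).
Hypothesis Gamma_sym : symmetric Gamma.
Hypothesis Gamma_irr : irreflexive Gamma.
Implicit Types (w : word V) (g h : raag Gamma).
Local Notation RG := (raag_relators Gamma).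
Local Open Scope group_scope.

Lemma reduced_nseq k (v : V) s : reduced Gamma (nseq k (v, s)).
Proof.
elim: k => //= k ->; rewrite andbT; elim: k => //= k IH.
by rewrite negb_or negb_and IH orbT andbT /flip_letter xpair_eqE /= andbC; case: s {IH}.
Qed.

Lemma reduced_run u k (v : V) s : reduced Gamma u ->
  elt RG u = elt RG (nseq k (v, s)) -> u = nseq k (v, s).
Proof.
move=> ru /(reduced_teq_elt Gamma_sym Gamma_irr ru (reduced_nseq k v s)).
move=> /(teq_perm Gamma_irr) pe.
have /all_pred1P -> : all (pred1 (v, s)) u.
  by rewrite (perm_all _ pe) all_nseq /= eqxx orbT.
by rewrite (perm_size pe) size_nseq.
Qed.

(** Combinatorial counterpart of an excursion at most K; like the excursion, it takes all geodesics
    into account. *)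
Definition run_bounded (v : V) (K : nat) g :=
  forall w s, elt RG w = g -> size w = word_length g ->
    ~~ infix (nseq K.+1 (v, s)) w.

(** A crude bound, which serves to make the sets under [sup] bounded. *)
Lemma run_bounded_length v g : run_bounded v (word_length g) g.
Proof.
move=> w s _ <-; apply/negP => /size_infix; rewrite size_nseq.
by rewrite ltnn.
Qed.

(** The part of the geodesic between a and b spells a reduced word for a power of v, hence is itself
    a run of v. *)
Lemma coset_dist_bound (v : V) K g p t a b : run_bounded v K g ->
  geodesic 1 g p -> a \in 1 :: p -> b \in 1 :: p ->
  left_coset t (vertex_group Gamma v) a -> left_coset t (vertex_group Gamma v) b ->
  (word_dist a b <= K)%N.
Proof.
move=> rb [pp pl ps] /(nthP 1)[i ip <-] /(nthP 1)[j jp <-].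
have [w pE sw] := path_trace pp; rewrite pE /= size_scanl !ltnS in ip jp.
have wE : elt RG w = g.
  rewrite -pl pE (last_nth 1) nth_trace_path size_scanl ?take_size ?mul1g //.
have wg : size w = word_length g by rewrite sw ps /word_dist invg1 mul1g.
wlog ij : i j ip jp / (i <= j)%N.
  move=> h; have [|/ltnW ij] := leqP i j; first exact: h.
  move=> ha hb; have := h j i jp ip ij hb ha.
  by rewrite /word_dist -word_lengthV invgM invgK.
rewrite pE !nth_trace_path // !mul1g => -[h1 h1H aE] [h2 h2H bE].
set u := take (j - i) (drop i w).
have jE : elt RG (take j w) = elt RG (take i w) * elt RG u.
  by rewrite -elt_cat /u -takeD subnKC.
have uE : word_dist (elt RG (take i w)) (elt RG (take j w)) = word_length (elt RG u).
  by rewrite /word_dist jE mulKg.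
have wsplit : w = take i w ++ u ++ drop (j - i) (drop i w).
  by rewrite /u !cat_take_drop.
have ru : reduced Gamma u.
  apply/reducedP => //; apply: (@geodesic_infix _ _ (take i w) _ (drop (j - i) (drop i w))).
  by rewrite -wsplit wE.
have [k [s ukE]] : exists k s, elt RG u = elt RG (nseq k (v, s)).
  move: h1H h2H => /cyclic_subgroupP[k1 [s1 h1E]] /cyclic_subgroupP[k2 [s2 h2E]].
  have -> : elt RG u = h1^-1 * h2.
    by rewrite -[LHS](mulKg (elt RG (take i w))) -jE -aE -bE invgM -!mulgA mulKg.
  by rewrite h1E h2E elt_nseqV; apply: elt_nseq_mul.
rewrite uE (word_length_reduced Gamma_sym Gamma_irr ru) leqNgt; apply/negP => Ku.
have uk := reduced_run ru ukE; rewrite uk size_nseq in Ku.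
have := rb w s wE wg => /negP[]; apply/infixP.
exists (take i w), (nseq (k - K.+1) (v, s) ++ drop (j - i) (drop i w)).
by rewrite [LHS]wsplit uk -{1}(subnKC Ku) nseqD -!catA.
Qed.

Local Open Scope ring_scope.

(** The condition 0 <= c covers the empty set, whose [sup] is 0; it arises from cosets that the path
    does not meet. *)
Lemma sup_le_ge0 (S : set R) (c : R) : 0 <= c -> ubound S c -> sup S <= c.
Proof.
move=> c0 ub; have [->|S0] := eqVneq S set0; first by rewrite sup0.
by apply: ge_sup => //; apply/set0P.
Qed.

Lemma diam_le (v : V) K g p t : run_bounded v K g -> geodesic 1%g g p ->
  diam R ([set` 1%g :: p] `&` left_coset t (vertex_group Gamma v)) <= K%:R.
Proof.
move=> rb gp; apply: sup_le_ge0 => // _ [[a b] [[/= ap aH] [bp bH]] <-].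
by rewrite ler_nat (coset_dist_bound rb gp ap bp aH bH).
Qed.

Lemma path_excursion_le (v : V) K g p : run_bounded v K g -> geodesic 1%g g p ->
  path_excursion R (vertex_group Gamma v) (1%g :: p) <= K%:R.
Proof.
by move=> rb gp; apply: sup_le_ge0 => // _ [t _ <-]; apply: diam_le rb gp.
Qed.

Lemma excursion_le (v : V) K g : run_bounded v K g ->
  excursion R (vertex_group Gamma v) g <= K%:R.
Proof.
by move=> rb; apply: sup_le_ge0 => // _ [p gp <-]; apply: path_excursion_le rb gp.
Qed.

(** The two ends of the run lie in one coset, at distance k. *)
Lemma excursion_ge (v : V) k w : reduced Gamma w ->
  infix (nseq k (v, false)) w ->
  k%:R <= excursion R (vertex_group Gamma v) (elt RG w).
Proof.
move=> rw /infixP[a [b wE]]; set g := elt RG w; set p := trace_path (1%g : raag Gamma) w.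
have gp : geodesic 1%g g p by apply/geodesic_trace_path/reducedP.
have rb := @run_bounded_length v g.
have tr i : (i <= size w)%N -> elt RG (take i w) \in 1%g :: p.
  move=> iw; rewrite -[elt _ _]mul1g -nth_trace_path // mem_nth //= size_scanl.
  by rewrite ltnS.
pose H := left_coset (elt RG a) (vertex_group Gamma v).
have aE : elt RG a \in 1%g :: p.
  have -> : a = take (size a) w by rewrite wE take_size_cat.
  by apply: tr; rewrite wE size_cat leq_addr.
have akE : elt RG (a ++ nseq k (v, false)) \in 1%g :: p.
  have -> : a ++ nseq k (v, false) = take (size (a ++ nseq k (v, false))) w.
    by rewrite wE catA take_size_cat.
  by apply: tr; rewrite wE catA [in leqRHS]size_cat leq_addr.
apply: (@le_trans _ _ (diam R ([set` 1%g :: p] `&` H))).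
  apply: ub_le_sup.
    exists (word_length g)%:R => _ [[x y] [[/= xp xH] [yp yH]] <-].
    by rewrite ler_nat (coset_dist_bound rb gp xp yp xH yH).
  exists (elt RG a, elt RG (a ++ nseq k (v, false))) => /=.
    split; split=> //=.
      by exists 1%g; rewrite ?mulg1 //; apply/cyclic_subgroupP; exists 0%N, false.
    exists (elt RG (nseq k (v, false))); last by rewrite elt_cat.
    by apply/cyclic_subgroupP; exists k, false.
  rewrite /word_dist elt_cat mulKg word_length_reduced ?size_nseq //.
  exact: reduced_nseq.
apply: (@le_trans _ _ (path_excursion R (vertex_group Gamma v) (1%g :: p))).
  apply: ub_le_sup; last by exists (elt RG a).
  by exists (word_length g)%:R => _ [t _ <-]; apply: diam_le rb gp.
apply: ub_le_sup; last by exists p.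
by exists (word_length g)%:R => _ [q gq <-]; apply: path_excursion_le rb gq.
Qed.

End Excursion.

(** * Cardinality inequalities for finite sets *)

Section SetCard.
Implicit Types T U : choiceType.

Lemma mem_fset_set T (A : set T) x : finite_set A -> (x \in fset_set A) <-> A x.
Proof. by move=> fA; rewrite in_fset_set //; split=> [/set_mem|/mem_set]. Qed.

Lemma set_card_le_size T (A : set T) (s : seq T) : finite_set A ->
  (forall x, A x -> x \in s) -> (set_card A <= size s)%N.
Proof.
move=> fA As; apply: uniq_leq_size; first exact: fset_uniq.
by move=> x /(mem_fset_set _ fA)/As.
Qed.

Lemma size_le_set_card T (A : set T) (s : seq T) : finite_set A -> uniq s ->
  (forall x, x \in s -> A x) -> (size s <= set_card A)%N.
Proof.
by move=> fA us sA; apply: uniq_leq_size us _ => x /sA/(mem_fset_set _ fA).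
Qed.

Lemma set_card_sub T (A B : set T) : finite_set B -> A `<=` B ->
  (set_card A <= set_card B)%N.
Proof.
move=> fB AB; apply: set_card_le_size; first exact: sub_finite_set fB.
by move=> x /AB/(mem_fset_set _ fB).
Qed.

Lemma set_card_image2 T1 T2 U (A : set T1) (B : set T2) (C : set U)
    (f : T1 -> T2 -> U) :
  finite_set A -> finite_set B -> finite_set C ->
  (forall c, C c -> exists a b, [/\ A a, B b & c = f a b]) ->
  (set_card C <= set_card A * set_card B)%N.
Proof.
move=> fA fB fC Cf.
apply: (@leq_trans (size [seq f a b | a <- fset_set A, b <- fset_set B])); last first.
  by rewrite !size_allpairs.
apply: set_card_le_size => // c /Cf[a [b [/(mem_fset_set _ fA) Aa /(mem_fset_set _ fB) Bb ->]]].
by apply/allpairsP; exists (a, b).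
Qed.

(** f need only be injective among pairs with the same label h; in the applications the label is the
    pair of signs of a connector. *)
Lemma set_card_inj2 T1 T2 U (W : finType) (A : set T1) (B : set T2) (C : set U)
    (f : T1 -> T2 -> U) (h : T1 -> T2 -> W) :
  finite_set A -> finite_set B -> finite_set C ->
  (forall a b, A a -> B b -> C (f a b)) ->
  (forall a b a' b', A a -> B b -> A a' -> B b' ->
     f a b = f a' b' -> h a b = h a' b' -> a = a' /\ b = b') ->
  (set_card A * set_card B <= set_card C * #|W|)%N.
Proof.
move=> fA fB fC fABC finj; rewrite cardE.
have := @uniq_leq_size _ [seq (f a b, h a b) | a <- fset_set A, b <- fset_set B]
   [seq (c, w) | c <- fset_set C, w <- enum W]; rewrite !size_allpairs; apply.
  apply: allpairs_uniq; rewrite ?fset_uniq //.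
  move=> [a b] [a' b'] /allpairsP[[x y] /= [/(mem_fset_set _ fA) Ax /(mem_fset_set _ fB) By [-> ->]]].
  move=> /allpairsP[[x' y'] /= [/(mem_fset_set _ fA) Ax' /(mem_fset_set _ fB) By' [-> ->]]].
  by move=> [e1 e2]; have [-> ->] := finj _ _ _ _ Ax By Ax' By' e1 e2.
move=> _ /allpairsP[[x y] /= [/(mem_fset_set _ fA) Ax /(mem_fset_set _ fB) By ->]].
apply/allpairsP; exists (f x y, h x y); split=> //=; last by rewrite mem_enum.
exact/(mem_fset_set _ fC)/fABC.
Qed.

Lemma set_card_bigcup T (I : eqType) (A : set T) (r : seq I) (F : I -> set T) :
  finite_set A -> (forall i, finite_set (F i)) ->
  (forall x, A x -> exists2 i, i \in r & F i x) ->
  (set_card A <= \sum_(i <- r) set_card (F i))%N.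
Proof.
move=> fA fF AF.
have -> : (\sum_(i <- r) set_card (F i) =
    size (flatten [seq (fset_set (F i) : seq T) | i <- r]))%N.
  by rewrite size_flatten /shape -map_comp sumnE big_map.
apply: set_card_le_size => // x /AF[i ir /(mem_fset_set _ (fF i)) Fx].
by apply/flattenP; exists (fset_set (F i) : seq T) => //; apply/mapP; exists i.
Qed.

Lemma set_card_II n : set_card `I_n = n.
Proof. exact/card_fset_set/card_eqxx. Qed.

Lemma set_cardU T (A B : set T) : finite_set A -> finite_set B ->
  (set_card (A `|` B) <= set_card A + set_card B)%N.
Proof. by move=> fA fB; rewrite /set_card fset_setU // leq_card_fsetU. Qed.

End SetCard.

(** * Counting in the spheres of a RAAG *)

Section RaagCount.
Variables (V : finType) (Gamma : rel V).
Hypothesis Gamma_sym : symmetric Gamma.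
Hypothesis Gamma_irr : irreflexive Gamma.
Implicit Types (w : word V) (g h : raag Gamma).
Local Notation RG := (raag_relators Gamma).
Local Notation S := (@sphere V RG).
Local Notation a n := (set_card (S n)).

(* The n-sphere of the subgroup generated by the vertices satisfying P. *)
Definition subsphere (P : pred V) n : set (raag Gamma) :=
  [set g | exists w, [/\ reduced Gamma w, size w = n,
                         all (fun l => P l.1) w & elt RG w = g]].

Lemma subsphere_sphere P n : subsphere P n `<=` S n.
Proof. by move=> g [w [/reducedP-/(_ Gamma_sym Gamma_irr) sw <- _ <-]]. Qed.

Lemma finite_subsphere P n : finite_set (subsphere P n).
Proof. exact: sub_finite_set (@subsphere_sphere P n) (finite_sphere _ _). Qed.

Lemma sphere_predT n : S n = subsphere predT n.
Proof.
apply/seteqP; split=> g; last exact: subsphere_sphere.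
move=> /= <-; exists (geo g); split; rewrite ?reduced_geo ?size_geo ?geoK //.
exact: all_predT.
Qed.

Lemma subsphere_submult P n m :
  (set_card (subsphere P (n + m)) <= set_card (subsphere P n) * set_card (subsphere P m))%N.
Proof.
apply: (@set_card_image2 _ _ _ _ _ _ (fun g h => (g * h)%g)); try exact: finite_subsphere.
move=> _ [w [rw sw aw <-]].
exists (elt RG (take n w)), (elt RG (drop n w)); split.
- exists (take n w); split=> //.
  + by move: rw; rewrite -{1}(cat_take_drop n w) => /reduced_catl.
  + by rewrite size_take sw; case: ltnP => //; lia.
  + by move: aw; rewrite -{1}(cat_take_drop n w) all_cat => /andP[].
- exists (drop n w); split=> //.
  + by move: rw; rewrite -{1}(cat_take_drop n w) => /reduced_catr.
  + by rewrite size_drop sw addKn.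
  + by move: aw; rewrite -{1}(cat_take_drop n w) all_cat => /andP[].
- by rewrite -elt_cat cat_take_drop.
Qed.

Lemma sphere_submult n m : (a (n + m) <= a n * a m)%N.
Proof. by rewrite !sphere_predT subsphere_submult. Qed.

(** The group is a direct product: a geodesic word can be sorted into its letters in P followed by
    the others, without changing its length. *)
Lemma sphere_prod_le (P : pred V) n : (forall x y, P x -> ~~ P y -> Gamma x y) ->
  (a n <= \sum_(0 <= i < n.+1)
            set_card (subsphere P i) * set_card (subsphere (predC P) (n - i)))%N.
Proof.
move=> PG.
pose F i := [set g | exists g1 g2, [/\ subsphere P i g1,
  subsphere (predC P) (n - i) g2 & g = (g1 * g2)%g]].
have fF i : finite_set (F i).
  apply: (@sub_finite_set _ _ [set (g1 * g2)%g |
    g1 in subsphere P i & g2 in subsphere (predC P) (n - i)]).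
    by move=> _ [g1 [g2 [h1 h2 ->]]]; exists g1 => //; exists g2.
  by apply: finite_image2; apply: finite_subsphere.
apply: (@leq_trans (\sum_(0 <= i < n.+1) set_card (F i))); last first.
  apply: leq_sum => i _; apply: (@set_card_image2 _ _ _ _ _ _ (fun g h => (g * h)%g)) => //;
    exact: finite_subsphere.
apply: set_card_bigcup => //; first exact: finite_sphere.
move=> g gn; set w := geo g; pose p := fun l : V * bool => P l.1.
pose w1 := [seq l <- w | p l]; pose w2 := [seq l <- w | predC p l].
have e : teq Gamma w (w1 ++ w2).
  move=> x y nG; rewrite filter_cat -!filter_predI.
  (* Noncommuting vertices lie on the same side of P, so one of the two projected pieces is
     empty. *)
  have [Px|nPx] := boolP (P x).
    have Py : P y by apply: contraNT nG => /(PG _ _ Px).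
    rewrite [X in _ ++ X](eq_filter (a2 := pred0)) ?filter_pred0 ?cats0.
      apply: eq_filter => l /=; rewrite /on_pair /p; case: eqP => [->|_] /=; first by rewrite Px.
      by case: eqP => [->|_] //=; rewrite Py.
    move=> l /=; rewrite /on_pair /p; case: eqP => [->|_] /=; first by rewrite Px.
    by case: eqP => [->|_] //=; rewrite Py.
  have nPy : ~~ P y by apply: contra nG => Py; rewrite Gamma_sym; apply: PG.
  rewrite [X in X ++ _](eq_filter (a2 := pred0)) ?filter_pred0 ?cat0s.
    apply: eq_filter => l /=; rewrite /on_pair /p; case: eqP => [->|_] /=; first by rewrite nPx.
    by case: eqP => [->|_] //=; rewrite nPy.
  move=> l /=; rewrite /on_pair /p; case: eqP => [->|_] /=; first by rewrite (negPf nPx).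
  by case: eqP => [->|_] //=; rewrite (negPf nPy).
have sw : size w1 + size w2 = n.
  by rewrite -size_cat -(teq_size Gamma_irr e) size_geo.
have rw := reduced_teq Gamma_sym Gamma_irr e (reduced_geo Gamma_sym Gamma_irr g).
exists (size w1); first by rewrite mem_index_iota; lia.
exists (elt RG w1), (elt RG w2); split.
- by exists w1; split=> //; [apply: reduced_catl rw|apply: filter_all].
- by exists w2; split=> //; [apply: reduced_catr rw|lia|apply: filter_all].
- by rewrite -elt_cat -(elt_teq Gamma_sym Gamma_irr e) geoK.
Qed.

(** Geodesic words of one element are permutations of each other, so none of them contains v. *)
Lemma subsphere_run_bounded P v n g : ~~ P v -> subsphere P n g -> run_bounded v 0 g.
Proof.
move=> nPv [w [rw _ aw wg]] w' s w'g sw'; apply/negP => /infixP[b [c w'E]].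
have rw' : reduced Gamma w' by apply/reducedP; rewrite ?w'g.
have /(reduced_teq_elt Gamma_sym Gamma_irr rw rw')/(teq_perm Gamma_irr) pe :
  elt RG w = elt RG w' by rewrite wg w'g.
by move: aw; rewrite (perm_all _ pe) w'E !all_cat /= (negPf nPv) andbF.
Qed.

(** The words x^i y^(n-i) differ in their number of letters x. The bound later forces the growth
    rate above 1. *)
Lemma sphere_card_gt n : (1 < #|V|)%N -> (n < a n)%N.
Proof.
move=> /card_gt1P[x [y [_ _ xy]]].
pose f i := elt RG (pos (nseq i x ++ nseq (n - i) y)).
have rf i : reduced Gamma (pos (nseq i x ++ nseq (n - i) y)) by apply: reduced_pos.
have -> : n.+1 = size [seq f i | i <- iota 0 n.+1] by rewrite size_map size_iota.
apply: size_le_set_card; first exact: finite_sphere.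
  rewrite map_inj_in_uniq ?iota_uniq // => i j _ _.
  move=> /(reduced_teq_elt Gamma_sym Gamma_irr (rf i) (rf j))/(teq_count Gamma_irr (x, false)).
  rewrite /pos !map_cat !map_nseq !count_cat !count_nseq /= eqxx !mul1n.
  have -> : (y, false) == (x, false) = false by rewrite xpair_eqE eq_sym (negPf xy).
  by rewrite !mul0n !addn0.
move=> g /mapP[i]; rewrite mem_iota => /andP[_ iN] ->.
rewrite /sphere /= word_length_reduced // size_map size_cat !size_nseq.
by lia.
Qed.

Lemma sphere_le_ball n : (a n <= set_card (@word_ball V RG n))%N.
Proof.
by apply: set_card_sub (finite_word_ball _ _) _ => g; rewrite /word_ball /= => ->.
Qed.

Lemma ball_le_sum n : (set_card (@word_ball V RG n) <= \sum_(0 <= i < n.+1) a i)%N.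
Proof.
apply: set_card_bigcup; [exact: finite_word_ball|by move=> i; apply: finite_sphere|].
by move=> g gn; exists (word_length g) => //; rewrite mem_index_iota.
Qed.

Definition has_run (v : V) k n : set (raag Gamma) :=
  S n `&` [set g | ~ run_bounded v k g].

(** Union bound over the sign of the run and its starting position i; the test guards the truncated
    subtraction. *)
Lemma has_run_card v k n : (set_card (has_run v k n) <=
  2 * \sum_(0 <= i < n.+1) if (i + k.+1 <= n)%N then a i * a (n - k.+1 - i) else 0)%N.
Proof.
pose F (si : bool * nat) := [set g | exists g1 g2, [/\ (si.2 + k.+1 <= n)%N, S si.2 g1,
  S (n - k.+1 - si.2) g2 & g = (g1 * (elt RG (nseq k.+1 (v, si.1)) * g2))%g]].
have fF si : finite_set (F si).
  apply: (@sub_finite_set _ _ [set (g1 * (elt RG (nseq k.+1 (v, si.1)) * g2))%g |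
      g1 in S si.2 & g2 in S (n - k.+1 - si.2)]).
    by move=> _ [g1 [g2 [_ h1 h2 ->]]]; exists g1 => //; exists g2.
  by apply: finite_image2; apply: finite_sphere.
have := @set_card_bigcup _ _ (has_run v k n)
  [seq (s, i) | s <- [:: true; false], i <- index_iota 0 n.+1] F.
move=> /(_ _ fF) h; apply: leq_trans (h _ _) _.
- by apply: sub_finite_set (@subIsetl _ _ _) (finite_sphere _ _).
- move=> g [gn nb]; have [w [s [wg sw iw]]] : exists w s,
    [/\ elt RG w = g, size w = word_length g & infix (nseq k.+1 (v, s)) w].
    apply: contrapT => no; apply: nb => w s wg sw; apply/negP => iw.
    by apply: no; exists w, s.
  have [b [c wE]] : exists b c : word V, w = b ++ nseq k.+1 (v, s) ++ c.
    exact/infixP.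
  have snw : size w = n by rewrite sw.
  have gw : size w = word_length (elt RG w) by rewrite wg.
  rewrite wE !size_cat size_nseq in snw.
  exists (s, size b).
    by apply/allpairsP; exists (s, size b); split; rewrite ?mem_index_iota //=; [case: s {wE iw}|lia].
  exists (elt RG b), (elt RG c); split=> /=; first by lia.
  + by apply/esym/(@geodesic_infix _ _ [::] b (nseq k.+1 (v, s) ++ c)); rewrite -wE.
  + have -> : (n - k.+1 - size b = size c)%N by lia.
    apply/esym/(@geodesic_infix _ _ (b ++ nseq k.+1 (v, s)) c [::]).
    by rewrite cats0 -catA -wE.
  + by rewrite -wg wE !elt_cat.
move: (index_iota 0 n.+1) => r.
rewrite big_allpairs_dep !big_cons big_nil /= addn0 mul2n -addnn.
apply: leq_add; apply: leq_sum => i _; (case: ifPn => ik; last by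
  rewrite leqn0 /set_card; apply/eqP; rewrite (_ : F _ = set0) ?fset_set0 ?cardfs0 //;
  apply/seteqP; split=> // g [g1 [g2 [/=]]]; rewrite (negPf ik)).
- apply: (@set_card_image2 _ _ _ _ _ _
    (fun g1 g2 => (g1 * (elt RG (nseq k.+1 (v, true)) * g2))%g)) => //;
    try exact: finite_sphere.
  by move=> _ [g1 [g2 [_ h1 h2 ->]]]; exists g1, g2.
- apply: (@set_card_image2 _ _ _ _ _ _
    (fun g1 g2 => (g1 * (elt RG (nseq k.+1 (v, false)) * g2))%g)) => //;
    try exact: finite_sphere.
  by move=> _ [g1 [g2 [_ h1 h2 ->]]]; exists g1, g2.
Qed.

(** * Counting by gluing with connectors, in the irreducible case *)

Section Irreducible.
Hypothesis irred : raag_irreducible Gamma.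
Hypothesis nonelem : raag_non_elementary V.

(* Gluing g and h with a connector in the middle is injective up to the choice
   of two signs. *)
Lemma sphere_supermult (v : V) : exists d, forall n m,
  (a n * a m <= 4 * a (n + m + d))%N.
Proof.
have [z [p [zp zlast pcov zhead [zv znv]]]] := covering_loop Gamma_sym irred nonelem v.
exists (1 + (size p).+1.*2)%N => n m.
(* Each pair of elements gets its own signs; the four possibilities account for the factor 4. *)
have /choice[sg sgP] : forall gh : raag Gamma * raag Gamma, exists ss : bool * bool,
  reduced Gamma (conn v z p 1 ss.1 ss.2 (geo gh.1) (geo gh.2)).
  move=> gh; have [ss /andP[h1 h2]] := conn_signs Gamma_irr z (geo gh.1) (geo gh.2).
  by exists ss; apply: reduced_conn => //; apply: reduced_geo.
rewrite (_ : 4 * _ = a (n + m + (1 + (size p).+1.*2)) * #|{: bool * bool}|)%N; last first.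
  by rewrite card_prod card_bool mulnC.
apply: (@set_card_inj2 _ _ _ _ _ _ _
  (fun g h => elt RG (conn v z p 1 (sg (g, h)).1 (sg (g, h)).2 (geo g) (geo h)))
  (fun g h => sg (g, h))); try exact: finite_sphere.
  move=> g h gn hm; rewrite /sphere /= word_length_reduced ?size_conn ?size_geo //.
    by rewrite gn hm addnA.
move=> g h g' h' gn hm gn' hm' e s.
have r1 := sgP (g, h); have r2 := sgP (g', h'); rewrite /= in r1 r2.
rewrite s in e r1.
have [|e1 e2] := conn_inj Gamma_sym Gamma_irr zp zlast pcov zv r1 r2 e.
  by rewrite !size_geo // gn gn'.
by rewrite !geoK in e1 e2.
Qed.

(** One geodesic and one sign are inspected: a run found there already bounds the excursion from
    below. *)
Definition avoids (v : V) k n : set (raag Gamma) :=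
  S n `&` [set g | ~~ infix (nseq k.+1 (v, false)) (geo g)].

(* The connector can be inserted at any of the n+1 points of a geodesic of g. *)
Lemma avoids_card (v : V) : exists d, forall k n, (d <= k)%N ->
  (set_card (avoids v k n) * n.+1 <= 4 * a (n + k + d))%N.
Proof.
have [z [p [zp zlast pcov zhead [zv znv]]]] := covering_loop Gamma_sym irred nonelem v.
(* The glued word has length n + (k+1) + 2 (size p + 1). The condition d <= k also gives the size p
   <= k that [conn_inj_avoid] demands. *)
exists (1 + (size p).+1.*2)%N => k n dk.
pose cn g i s := conn v z p k.+1 s.1 s.2 (take i (geo g)) (drop i (geo g)).
have redT g i : reduced Gamma (take i (geo g)) /\ reduced Gamma (drop i (geo g)).
  have := reduced_geo Gamma_sym Gamma_irr g; rewrite -{1}(cat_take_drop i (geo g)).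
  by move=> r; split; [apply: reduced_catl r|apply: reduced_catr r].
have /choice[sg sgP] : forall gi : raag Gamma * nat, exists ss : bool * bool,
  reduced Gamma (cn gi.1 gi.2 ss).
  move=> [g i] /=; have [r1 r2] := redT g i.
  have [ss /andP[h1 h2]] := conn_signs Gamma_irr z (take i (geo g)) (drop i (geo g)).
  by exists ss; apply: reduced_conn.
rewrite -[X in (_ * X)%N](set_card_II n.+1).
rewrite (_ : 4 * _ = a (n + k + (1 + (size p).+1.*2)) * #|{: bool * bool}|)%N; last first.
  by rewrite card_prod card_bool mulnC.
apply: (@set_card_inj2 _ _ _ _ _ _ _ (fun g i => elt RG (cn g i (sg (g, i))))
  (fun g i => sg (g, i))); try exact: finite_sphere.
- by apply: sub_finite_set (@subIsetl _ _ _) (finite_sphere _ _).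
- exact: finite_II.
- move=> g i [gn _] iN; rewrite /sphere /=.
  rewrite word_length_reduced ?size_conn //; last exact: (sgP (g, i)).
  have := congr1 size (cat_take_drop i (geo g)); rewrite size_cat size_geo // gn.
  by move=> ->; rewrite -!addnA addSnnS.
move=> g i g' i' [gn ga] iN [gn' ga'] iN' e s.
have r1 := sgP (g, i); have r2 := sgP (g', i'); rewrite /= in r1 r2.
rewrite s in e r1.
have na h j : ~~ infix (nseq k.+1 (v, false)) (geo h) ->
    ~~ infix (nseq k.+1 (v, false)) (take j (geo h)).
  apply: contra => /infixP[b [c hE]]; apply/infixP; exists b, (c ++ drop j (geo h)).
  by rewrite -{1}(cat_take_drop j (geo h)) hE -!catA.
have s1 : size (take i (geo g)) = size (take i' (geo g')).
  apply: (conn_inj_avoid Gamma_sym Gamma_irr zp zlast pcov zhead zv znv) r1 r2 e; try exact: na.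
  by move: dk; lia.
have [e1 e2] := conn_inj Gamma_sym Gamma_irr zp zlast pcov zv r1 r2 e s1.
split.
  rewrite -(geoK Gamma_sym Gamma_irr g) -(geoK Gamma_sym Gamma_irr g').
  by rewrite -(cat_take_drop i (geo g)) -(cat_take_drop i' (geo g')) !elt_cat e1 e2.
have take_len (h : raag Gamma) (j : nat) : word_length h = n -> (j < n.+1)%N ->
    size (take j (geo h)) = j.
  by move=> hn jn; rewrite size_take_min size_geo // hn; apply/minn_idPl.
by rewrite -(take_len g i gn iN) s1 take_len.
Qed.

End Irreducible.
End RaagCount.

(** * Growth and summability of multiplicative sequences *)

Section Sequences.
Variable R : realType.
Local Open Scope ring_scope.

(* Fekete's lemma, for a sequence both sub- and supermultiplicative up to a
   constant. *)
Lemma quasi_multiplicative_growth (a : nat -> nat) (K : nat) :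
  (forall n m, (a (n + m) <= a n * a m)%N) ->
  (forall n m, (a n * a m <= K * a (n + m))%N) ->
  (forall n, (n < a n)%N) ->
  exists lam : R, 1 < lam /\
    forall n, lam ^+ n <= (a n)%:R /\ (a n)%:R <= K%:R * lam ^+ n.
Proof.
move=> asub asup big.
have K0 : (0 < K)%N.
  have := asup 0%N 0%N; case: K {asup} => //; have := big 0%N.
  by rewrite mul0n leqn0 muln_eq0 orbb; lia.
have KR : 0 < K%:R :> R by rewrite ltr0n.
have a0 n : 0 < (a n)%:R :> R by rewrite ltr0n; apply: leq_ltn_trans (big n).
have subX n m : (a (n * m.+1) <= a n ^ m.+1)%N.
  elim: m => [|m IH]; first by rewrite muln1 expn1.
  by rewrite mulnS expnS; apply: leq_trans (asub _ _) _; rewrite leq_mul2l IH orbT.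
have supX n m : (a n ^ m.+1 <= K ^ m * a (n * m.+1))%N.
  elim: m => [|m IH]; first by rewrite muln1 expn0 mul1n.
  rewrite expnS (mulnS n m.+1); apply: leq_trans (_ : a n * (K ^ m * a (n * m.+1)) <= _)%N.
    by rewrite leq_mul2l IH orbT.
  rewrite mulnCA expnSr -mulnA leq_mul2l asup orbT //.
(* Division by K makes the sequence supermultiplicative. Comparing at a common multiple of the
   indices, every root of b lies below every root of a; [lam] is the supremum of the former. *)
pose b n : R := (a n)%:R / K%:R.
have b0 n : 0 < b n by rewrite divr_gt0.
have key n m : b n.+1 `^ n.+1%:R^-1 <= (a m.+1)%:R `^ m.+1%:R^-1.
  have le : b n.+1 ^+ m.+1 <= (a m.+1)%:R ^+ n.+1.
    rewrite expr_div_n ler_pdivrMr ?exprn_gt0 // -!natrX -natrM ler_nat.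
    apply: leq_trans (supX _ _) _; rewrite mulnC mulnC [X in (_ <= X)%N]mulnC.
    apply: leq_mul; first by rewrite leq_pexp2l.
    by rewrite mulnC; apply: subX.
  have n0 : n.+1%:R != 0 :> R by rewrite pnatr_eq0.
  have m0 : m.+1%:R != 0 :> R by rewrite pnatr_eq0.
  pose r : R := (n.+1%:R * m.+1%:R)^-1.
  have -> : b n.+1 `^ n.+1%:R^-1 = (b n.+1 ^+ m.+1) `^ r.
    rewrite -powR_mulrn ?(ltW (b0 _)) // -powRrM; congr (_ `^ _).
    by rewrite /r invfM mulrCA mulfV // mulr1.
  have -> : (a m.+1)%:R `^ m.+1%:R^-1 = ((a m.+1)%:R ^+ n.+1) `^ r.
    rewrite -powR_mulrn ?(ltW (a0 _)) // -powRrM; congr (_ `^ _).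
    by rewrite /r invfM mulrA mulfV // mul1r.
  apply: ge0_ler_powR le; rewrite ?nnegrE ?exprn_ge0 ?(ltW (b0 _)) //.
  by rewrite invr_ge0 mulr_ge0.
pose E := [set b n.+1 `^ n.+1%:R^-1 | n in [set: nat]].
have E0 : E !=set0 by exists (b 1 `^ 1%:R^-1); exists 0%N.
have ubE m : ubound E ((a m.+1)%:R `^ m.+1%:R^-1) by move=> _ [n _ <-]; apply: key.
pose lam := sup E.
have lam0 : 0 <= lam.
  apply: le_trans (_ : b 1 `^ 1%:R^-1 <= _); first exact: powR_ge0.
  by apply: ub_le_sup; [exists ((a 1)%:R `^ 1%:R^-1); apply: ubE|exists 0%N].
have hi n : (a n)%:R <= K%:R * lam ^+ n.
  case: n => [|n].
    rewrite expr0 mulr1 ler_nat; have := asup 0%N 0%N; rewrite addn0.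
    by rewrite leq_pmul2r //; apply: leq_ltn_trans (big 0%N).
  rewrite mulrC -ler_pdivrMr // -/(b _).
  have h : b n.+1 `^ n.+1%:R^-1 <= lam.
    by apply: ub_le_sup; [exists ((a 1)%:R `^ 1%:R^-1); apply: ubE|exists n].
  have := @ge0_ler_powR R n.+1%:R _ _ _ _ _ h.
  rewrite -powRrM mulVf ?pnatr_eq0 // powRr1 ?(ltW (b0 _)) // powR_mulrn //.
  by apply; rewrite ?nnegrE ?powR_ge0.
have lo n : lam ^+ n <= (a n)%:R.
  case: n => [|n]; first by rewrite expr0 ler1n; apply: leq_ltn_trans (big 0%N).
  have h : lam <= (a n.+1)%:R `^ n.+1%:R^-1 by apply: ge_sup => //; apply: ubE.
  have := @ge0_ler_powR R n.+1%:R _ _ _ _ _ h.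
  rewrite -powRrM mulVf ?pnatr_eq0 // powRr1 ?(ltW (a0 _)) // powR_mulrn //.
  by apply; rewrite ?nnegrE ?powR_ge0.
exists lam; split=> [|n]; last by split.
(* If [lam] were at most 1, then a K <= K, whereas K < a K. *)
rewrite ltNge; apply/negP => lam1; have := hi K; apply/negP; rewrite -ltNge.
apply: le_lt_trans (_ : K%:R < _); last by rewrite ltr_nat.
by rewrite -[leRHS]mulr1 ler_wpM2l // exprn_ile1.
Qed.

Lemma root_const_cvg (M : R) : 0 < M -> (fun n : nat => M `^ n%:R^-1) @ \oo --> (1 : R).
Proof.
move=> M0; rewrite -cvg_shiftS /=.
have -> : (fun n : nat => M `^ n.+1%:R^-1) = (@expR R \o (fun n => harmonic n * ln M)).
  by apply/funext => n /=; rewrite /powR gt_eqF.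
rewrite -(expR0 R); apply: continuous_cvg; first exact: continuous_expR.
by rewrite -[X in _ --> X](mul0r (ln M)); apply: cvgMr_tmp; apply: cvg_harmonic.
Qed.

Lemma root_limit (B : nat -> R) (lam M : R) : 0 < lam -> 0 < M ->
  (forall n, lam ^+ n <= B n /\ B n <= M * lam ^+ n) ->
  limn (fun n => B n `^ n%:R^-1) = lam.
Proof.
move=> lam0 M0 h; apply: cvg_lim => //.
have rt n : (lam ^+ n.+1) `^ n.+1%:R^-1 = lam.
  by rewrite -powR_mulrn ?(ltW lam0) // -powRrM mulfV ?pnatr_eq0 // powRr1 // ltW.
(* The shift drops n = 0, where the exponent is the default value 0^-1 = 0. *)
rewrite -cvg_shiftS /=.
apply: (@squeeze_cvgr _ _ _ _ (fun=> lam) (fun n => M `^ n.+1%:R^-1 * lam)).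
- near=> n; have [h1 h2] := h n.+1.
  have l0 : 0 <= lam ^+ n.+1 by rewrite exprn_ge0 // ltW.
  have B0 : 0 <= B n.+1 by apply: le_trans h1.
  apply/andP; split.
    rewrite -{1}(rt n); apply: ge0_ler_powR => //.
  rewrite -{1}(rt n) -powRM ?(ltW M0) //; apply: ge0_ler_powR => //.
  by rewrite nnegrE mulr_ge0 // ltW.
- exact: cvg_cst.
- rewrite -[X in _ --> X]mul1r; apply: cvgMr_tmp.
  by have := root_const_cvg M0; rewrite -cvg_shiftS.
Unshelve. all: by end_near. Qed.

Lemma geometric_sum_le (lam : R) n : 1 < lam ->
  \sum_(0 <= i < n.+1) lam ^+ i <= lam / (lam - 1) * lam ^+ n.
Proof.
move=> lam1; have l0 : 0 < lam - 1 by lra.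
elim: n => [|n IH].
  by rewrite big_nat1 expr0 mulr1 ler_pdivlMr //; lra.
rewrite big_nat_recr //=; apply: le_trans (lerD IH (lexx _)) _.
rewrite exprS mulrA -[X in _ + X]mul1r mulrA -mulrDl ler_wpM2r ?exprn_ge0 //; first by lra.
by rewrite le_eqVlt; apply/orP; left; apply/eqP; field; lra.
Qed.

(* If b N <= 1/2, the partial sums satisfy s_m <= s_N + s_m / 2. *)
Lemma submultiplicative_sum_bounded (b : nat -> R) :
  (forall n, 0 <= b n) -> (forall n m, b (n + m)%N <= b n * b m) ->
  b @ \oo --> 0 -> exists C, forall m, \sum_(0 <= i < m) b i <= C.
Proof.
move=> b0 sub /cvgr0Pnorm_le/(_ (2^-1)); rewrite invr_gt0 ltr0n => /(_ isT) [N _ hN].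
have bN : b N <= 2^-1 by apply: le_trans (ler_norm _) _; apply: hN => /=.
exists (2 * \sum_(0 <= i < N) b i) => m.
have bnd : \sum_(0 <= i < m) b i <= \sum_(0 <= i < N) b i + \sum_(0 <= i < m) b (N + i)%N.
  have -> : \sum_(0 <= i < m) b (N + i)%N = \sum_(N <= i < N + m) b i.
    have := @big_addn R 0 +%R 0%N (N + m)%N N xpredT b; rewrite add0n addKn => ->.
    by apply: eq_bigr => i _; rewrite addnC.
  rewrite -big_cat_nat //= ?leq_addr // addnC (@big_cat_nat _ _ _ m 0%N (m + N)) //= ?leq_addr //.
  by rewrite lerDl sumr_ge0.
have : \sum_(0 <= i < m) b (N + i)%N <= 2^-1 * \sum_(0 <= i < m) b i.
  rewrite mulr_sumr; apply: ler_sum => i _; apply: le_trans (sub _ _) _.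
  by rewrite ler_wpM2r.
by move: bnd; lra.
Qed.

(** The pairs i, n - i with n < m form a triangle inside the square of side m. *)
Lemma convolution_sum_le (b c : nat -> R) m :
  (forall n, 0 <= b n) -> (forall n, 0 <= c n) ->
  \sum_(0 <= n < m) \sum_(0 <= i < n.+1) b i * c (n - i)%N <=
  (\sum_(0 <= i < m) b i) * (\sum_(0 <= j < m) c j).
Proof.
move=> b0 c0.
have -> : \sum_(0 <= n < m) \sum_(0 <= i < n.+1) b i * c (n - i)%N =
    \sum_(0 <= i < m) \sum_(0 <= n < m | (i <= n)%N) b i * c (n - i)%N.
  rewrite (exchange_big_dep_nat predT) //=.
  apply: eq_big_nat => n /andP[_ nm]; rewrite (big_nat_widen 0 n.+1 m) //.
rewrite mulr_suml; apply: ler_sum_nat => i /andP[_ im].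
rewrite -mulr_sumr ler_wpM2l //.
have -> : \sum_(0 <= n < m | (i <= n)%N) c (n - i)%N = \sum_(0 <= j < m - i) c j.
  rewrite -(@big_nat_widenl _ _ _ i 0%N m xpredT) // -{1}[i]add0n big_addn.
  by apply: eq_bigr => j _; rewrite addnK.
by rewrite [leRHS](@big_cat_nat _ _ _ (m - i)) //= ?leq_subr // lerDl sumr_ge0.
Qed.

End Sequences.

(** Used as 2 (n+1) / n^2 <= 8 / (n+1), in the estimate of long runs. *)
Lemma square_succ_le n : (0 < n)%N -> (2 * n.+1 * n.+1 <= 8 * n ^ 2)%N.
Proof.
move=> n0; have n2 : (n.+1 <= 2 * n)%N by lia.
apply: leq_trans (_ : 2 * (2 * n) * (2 * n) <= _)%N; first by rewrite !leq_mul.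
by rewrite -mulnn; lia.
Qed.

(** * From irreducibility to growth and logarithmic excursion *)

Section Forward.
Variables (R : realType) (V : finType) (Gamma : rel V).
Hypothesis Gamma_sym : symmetric Gamma.
Hypothesis Gamma_irr : irreflexive Gamma.
Local Notation RG := (raag_relators Gamma).
Local Notation S := (@sphere V RG).
Local Notation a n := (set_card (S n)).
Local Open Scope ring_scope.

(** The length d of the connector is absorbed by a (n+m+d) <= a (n+m) * a d, whence K = 4 a d.
    Geometric summation transfers the growth from spheres to balls. *)
Lemma irreducible_growth : raag_irreducible Gamma -> raag_non_elementary V ->
  exists (lam : R) (K : nat), [/\ 1 < lam, growth_rate R RG = lam,
    forall n m, (a n * a m <= K * a (n + m))%N &
    forall n, lam ^+ n <= (a n)%:R /\ (a n)%:R <= K%:R * lam ^+ n].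
Proof.
move=> irred nonelem.
have /card_gt0P[v _] : (0 < #|V|)%N by apply: ltnW.
have [d dP] := sphere_supermult Gamma_sym Gamma_irr irred nonelem v.
pose K := (4 * a d)%N.
have KP n m : (a n * a m <= K * a (n + m))%N.
  apply: leq_trans (dP n m) _; rewrite /K -mulnA leq_mul2l /= mulnC.
  exact: sphere_submult.
have [lam [lam1 h]] := quasi_multiplicative_growth R (sphere_submult Gamma_sym Gamma_irr) KP
  (fun n => sphere_card_gt Gamma_sym Gamma_irr n nonelem).
exists lam, K; split=> //.
have K1 : 1 <= K%:R :> R by have [] := h 0%N; rewrite !expr0 mulr1 => h1 h2; apply: le_trans h2.
have l10 : 0 < lam - 1 by lra.
apply: (@root_limit _ _ _ (K%:R * (lam / (lam - 1)))).
- by lra.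
- by rewrite !mulr_gt0 ?invr_gt0 //; lra.
move=> n; split.
  by apply: le_trans (h n).1 _; rewrite ler_nat; apply: sphere_le_ball.
apply: (@le_trans _ _ (\sum_(0 <= i < n.+1) a i)%:R).
  by rewrite ler_nat; apply: ball_le_sum.
rewrite natr_sum; apply: (@le_trans _ _ (\sum_(0 <= i < n.+1) K%:R * lam ^+ i)).
  by apply: ler_sum => i _; apply: (h i).2.
rewrite -mulr_sumr -mulrA ler_wpM2l //.
exact: geometric_sum_le.
Qed.

(** With k1, k2 the integer parts of c1 ln n and c2 ln n, a run of k1 + 1 letters gives excursion
    above c1 ln n, and the absence of runs longer than k2 gives at most c2 ln n. *)
Lemma sphere_excursion_cover (c1 c2 : R) (v : V) n : 0 < c1 -> 0 < c2 -> (1 < n)%N ->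
  (a n <= set_card (S n `&`
            [set g | (c1 <= excursion R (vertex_group Gamma v) g / ln n%:R <= c2)%R]) +
          set_card (avoids v (Num.truncn (c1 * ln n%:R)%R) n : set (raag Gamma)) +
          set_card (has_run v (Num.truncn (c2 * ln n%:R)%R) n : set (raag Gamma)))%N.
Proof.
move=> c10 c20 n1; set A := (X in S n `&` X); set B := avoids _ _ _; set D := has_run _ _ _.
have ln0 : 0 < ln n%:R :> R by rewrite ln_gt0 // ltr1n.
have fS : finite_set (S n) by apply: finite_sphere.
have fin (T : set (raag Gamma)) : finite_set (S n `&` T).
  exact: sub_finite_set (@subIsetl _ _ _) fS.
apply: leq_trans (_ : set_card (S n `&` A `|` B `|` D) <= _)%N; last first.
  apply: leq_trans (set_cardU _ _) _ => //; [|exact: fin|].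
    by rewrite finite_setU; split; apply: fin.
  by rewrite leq_add2r; apply: set_cardU; apply: fin.
apply: set_card_sub; first by rewrite !finite_setU; split; [split|]; apply: fin.
move=> g gn.
have [rb|] := pselect (run_bounded v (Num.truncn (c2 * ln n%:R)) g); last by right.
left; have [iw|] := boolP (infix (nseq (Num.truncn (c1 * ln n%:R)).+1 (v, false)) (geo g));
  last by right.
left; split=> //; rewrite /A /= ler_pdivlMr // ler_pdivrMr //; apply/andP; split.
  have := excursion_ge R Gamma_sym Gamma_irr (reduced_geo Gamma_sym Gamma_irr g) iw.
  by rewrite geoK //; apply: le_trans; apply/ltW/truncnS_gt.
apply: le_trans (excursion_le R Gamma_sym Gamma_irr rb) _.
by rewrite truncn_le mulr_ge0 // ltW.
Qed.

Variables (lam : R) (K : nat).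
Hypothesis lam1 : 1 < lam.
Hypothesis supK : forall n m, (a n * a m <= K * a (n + m))%N.
Hypothesis lamK : forall n, lam ^+ n <= (a n)%:R /\ (a n)%:R <= K%:R * lam ^+ n.

Let lam0 : 0 < lam. Proof. by rewrite (lt_trans ltr01). Qed.

(** Each sign and position contributes at most a i * a j <= K a (i+j) <= K^2 lam^(n-k-1), where i +
    j = n - k - 1. *)
Lemma has_run_growth (v : V) k n :
  (set_card (has_run v k n : set (raag Gamma)))%:R * lam ^+ k.+1
  <= 2 * n.+1%:R * K%:R ^+ 2 * lam ^+ n.
Proof.
have h := has_run_card Gamma v k n.
apply: le_trans (_ : (2 * \sum_(0 <= i < n.+1) if (i + k.+1 <= n)%N
    then a i * a (n - k.+1 - i) else 0)%:R * lam ^+ k.+1 <= _).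
  by rewrite ler_wpM2r ?exprn_ge0 ?(ltW lam0) // ler_nat.
rewrite natrM -!mulrA ler_wpM2l //.
rewrite natr_sum mulr_suml.
apply: le_trans (_ : \sum_(0 <= i < n.+1) K%:R ^+ 2 * lam ^+ n <= _); last first.
  by rewrite sumr_const_nat subn0 mulr_natl expr2 mulrA.
apply: ler_sum => i _; case: ifP => [ik|_]; last first.
  by rewrite mul0r mulr_ge0 ?exprn_ge0 // ltW.
apply: le_trans (_ : (K%:R * (K%:R * lam ^+ (n - k.+1))) * lam ^+ k.+1 <= _).
  rewrite ler_wpM2r ?exprn_ge0 ?(ltW lam0) //.
  apply: le_trans (_ : (K * a (n - k.+1))%:R <= _).
    rewrite ler_nat; apply: leq_trans (supK _ _) _.
    have -> : (i + (n - k.+1 - i) = n - k.+1)%N by lia.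
    by [].
  by rewrite natrM ler_wpM2l //; apply: (lamK _).2.
by rewrite expr2 -!mulrA -exprD subnK //; lia.
Qed.

Lemma excursion_log (v : V) : raag_irreducible Gamma -> raag_non_elementary V ->
  log_excursion R (vertex_group Gamma v).
Proof.
move=> irred nonelem.
have [d dP] := avoids_card Gamma_sym Gamma_irr irred nonelem v.
have lnl : 0 < ln lam by rewrite ln_gt0.
(* With this c1, lam^k1 is at most about sqrt n and avoiding elements have proportion O(sqrt n / n).
   With this c2, lam^(k2+1) >= n^2 and long runs have proportion O(n / n^2). *)
pose c1 : R := (2 * ln lam)^-1; pose c2 : R := 2 / ln lam.
have c10 : 0 < c1 by rewrite invr_gt0 mulr_gt0.
have c20 : 0 < c2 by rewrite divr_gt0.
exists c1, c2; split=> //.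
pose C1 : R := 4 * K%:R * lam ^+ d; pose C2 : R := 8 * K%:R ^+ 2.
apply: (@squeeze_cvgr _ _ _ _
  (fun n => 1 - C1 * Num.sqrt (harmonic n) - C2 * harmonic n) (fun=> 1)); last 2 first.
- rewrite [X in _ --> X](_ : (1 : R) = 1 - C1 * Num.sqrt 0 - C2 * 0); last first.
    by rewrite sqrtr0 !mulr0 !subr0.
  have ch : @harmonic R @ \oo --> (0 : R) by apply: cvg_harmonic.
  apply: cvgB; last by apply: cvgMl_tmp.
  apply: cvgB; first exact: cvg_cst.
  by apply: cvgMl_tmp; apply: (continuous_cvg _ _ ch); apply: sqrt_continuous.
- exact: cvg_cst.
(* Ensures d <= k1 eventually, as [avoids_card] requires. *)
have dlog : \forall n \near \oo, d%:R <= c1 * ln (n%:R : R).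
  exists (Num.truncn (expR (d%:R / c1))).+1 => // n /= dn.
  rewrite -ler_pdivrMl // mulrC -(expRK (d%:R / c1)) ler_ln ?posrE ?expR_gt0 //.
    by apply/ltW/(lt_le_trans (truncnS_gt _)); rewrite ler_nat.
  by rewrite ltr0n; lia.
near=> n.
have n1 : (1 < n)%N by near: n; apply: nbhs_infty_gt.
have n0 : 0 < n%:R :> R by rewrite ltr0n; lia.
have ln0 : 0 <= ln n%:R :> R by rewrite ln_ge0 // ler1n; lia.
have dn : d%:R <= c1 * ln n%:R by near: n.
set k1 := Num.truncn (c1 * ln n%:R); set k2 := Num.truncn (c2 * ln n%:R).
have dk : (d <= k1)%N by rewrite truncn_ge_nat // mulr_ge0 // ltW.
have an0 : 0 < (a n)%:R :> R by apply: lt_le_trans (lamK n).1; rewrite exprn_gt0.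
have lamE k : lam ^+ k = expR (k%:R * ln lam) by rewrite expRM_natl lnK.
have nE : n%:R = expR (ln n%:R) :> R by rewrite lnK.
have lamk1 : lam ^+ k1 <= Num.sqrt n.+1%:R.
  rewrite -[leLHS]ger0_norm ?exprn_ge0 ?(ltW lam0) // -sqrtr_sqr ler_wsqrtr //.
  apply: le_trans (_ : n%:R <= _); last by rewrite ler_nat.
  rewrite -exprM lamE nE ler_expR natrM.
  have : k1%:R <= c1 * ln n%:R by rewrite truncn_le mulr_ge0 // ltW.
  move=> h; apply: le_trans (_ : c1 * ln n%:R * 2 * ln lam <= _).
    by rewrite !ler_wpM2r // ltW.
  by rewrite /c1 le_eqVlt; apply/orP; left; apply/eqP; field; rewrite gt_eqF.
have lamk2 : n%:R ^+ 2 <= lam ^+ k2.+1.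
  rewrite lamE nE -expRM_natl ler_expR.
  apply: le_trans (_ : c2 * ln n%:R * ln lam <= _).
    by rewrite /c2 le_eqVlt; apply/orP; left; apply/eqP; field; rewrite gt_eqF.
  rewrite ler_wpM2r //; first exact: ltW.
  exact/ltW/truncnS_gt.
have cov := sphere_excursion_cover v c10 c20 n1; rewrite -/k1 -/k2 in cov.
set P := set_card (S n `&` _) in cov; set B := set_card (avoids _ _ _) in cov.
set D := set_card (has_run _ _ _) in cov.
have BE : B%:R / (a n)%:R <= C1 * Num.sqrt (harmonic n).
  rewrite ler_pdivrMr //; apply: le_trans (_ : C1 * Num.sqrt (harmonic n) * lam ^+ n <= _); last first.
    rewrite ler_wpM2l //; last exact: (lamK n).1.
    by rewrite !mulr_ge0 ?sqrtr_ge0 ?exprn_ge0 // ltW.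
  have n10 : 0 < n.+1%:R :> R by [].
  rewrite -(ler_pM2r n10) -natrM; apply: le_trans (_ : (4 * a (n + k1 + d))%:R <= _).
    by rewrite ler_nat; apply: dP.
  rewrite natrM; apply: le_trans (_ : 4 * (K%:R * (lam ^+ n * Num.sqrt n.+1%:R * lam ^+ d)) <= _).
    rewrite ler_wpM2l //; apply: le_trans (lamK _).2 _; rewrite ler_wpM2l // !exprD.
    by rewrite ler_wpM2r ?exprn_ge0 ?(ltW lam0) // ler_wpM2l ?exprn_ge0 ?(ltW lam0).
  rewrite /C1 /harmonic /= sqrtrV //.
  have s0 : Num.sqrt n.+1%:R != 0 :> R by rewrite gt_eqF // sqrtr_gt0.
  have -> : n.+1%:R = Num.sqrt n.+1%:R ^+ 2 :> R by rewrite sqr_sqrtr.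
  rewrite sqrtr_sqr ger0_norm ?sqrtr_ge0 //.
  by rewrite le_eqVlt; apply/orP; left; apply/eqP; field.
have DE : D%:R / (a n)%:R <= C2 * harmonic n.
  rewrite ler_pdivrMr //; apply: le_trans (_ : C2 * harmonic n * lam ^+ n <= _); last first.
    rewrite ler_wpM2l //; last exact: (lamK n).1.
    by rewrite !mulr_ge0 // invr_ge0.
  have nn0 : 0 < n%:R ^+ 2 :> R by rewrite exprn_gt0.
  rewrite -(ler_pM2r nn0).
  apply: le_trans (_ : D%:R * lam ^+ k2.+1 <= _); first by rewrite ler_wpM2l.
  apply: le_trans (has_run_growth _ _ _) _.
  have -> : C2 * harmonic n * lam ^+ n * n%:R ^+ 2 =
     (8 * n%:R ^+ 2 / n.+1%:R) * K%:R ^+ 2 * lam ^+ n by rewrite /C2 /harmonic /=; ring.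
  rewrite ler_wpM2r ?exprn_ge0 ?(ltW lam0) // ler_wpM2r ?exprn_ge0 //.
  rewrite ler_pdivlMr // -!natrX -!natrM ler_nat.
  by apply: square_succ_le; apply: ltnW.
have aE : (a n)%:R <= P%:R + B%:R + D%:R :> R by rewrite -!natrD ler_nat.
rewrite [sphere_prob _ _ _](_ : _ = P%:R / (a n)%:R) //; apply/andP; split.
  have h : 1 <= P%:R / (a n)%:R + B%:R / (a n)%:R + D%:R / (a n)%:R :> R.
    by rewrite -[X in X + _]mulrDl -mulrDl ler_pdivlMr // mul1r.
  rewrite !lerBlDr; apply: le_trans h _; rewrite addrAC.
  by apply: lerD BE; apply: lerD DE.
rewrite ler_pdivrMr // mul1r ler_nat; apply: set_card_sub; first exact: finite_sphere.
exact: subIsetl.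
Unshelve. all: by end_near. Qed.

End Forward.

(** * From growth and logarithmic excursion to irreducibility *)

Section Backward.
Variables (R : realType) (V : finType) (Gamma : rel V).
Hypothesis Gamma_sym : symmetric Gamma.
Hypothesis Gamma_irr : irreflexive Gamma.
Local Notation RG := (raag_relators Gamma).
Local Notation S := (@sphere V RG).
Local Notation a n := (set_card (S n)).
Local Open Scope ring_scope.

(** Elements of the subgroup on P have no v in their geodesics, so their excursion is below the
    positive lower threshold. Hence the subsphere has at most (1 - p n) #S_n elements, where #S_n <=
    C lam^n. *)
Lemma subsphere_negligible (P : pred V) (v : V) (lam C : R) : ~~ P v ->
  0 < lam -> 0 < C -> (forall n, C^-1 <= (a n)%:R / lam ^+ n <= C) ->
  log_excursion R (vertex_group Gamma v) ->
  (fun n => (set_card (subsphere P n : set (raag Gamma)))%:R / lam ^+ n) @ \oo --> (0 : R).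
Proof.
move=> nPv lam0 C0 aC [c1 [c2 [c10 c20 cvg1]]].
set p := (fun n : nat => _) in cvg1.
apply: (@squeeze_cvgr _ _ _ _ (fun=> 0) (fun n => C * (1 - p n))); last 2 first.
- exact: cvg_cst.
- rewrite -[X in _ --> X](mulr0 C) -(subrr 1); apply: cvgMl_tmp.
  by apply: cvgB => //; apply: cvg_cst.
near=> n.
have n1 : (1 < n)%N by near: n; apply: nbhs_infty_gt.
have ln0 : 0 < ln n%:R :> R by rewrite ln_gt0 // ltr1n.
have ln' : 0 < lam ^+ n by rewrite exprn_gt0.
apply/andP; split; first by rewrite divr_ge0 // ltW.
have /andP[aC1 aC2] := aC n.
have an0 : 0 < (a n)%:R :> R.
  have : 0 < (a n)%:R / lam ^+ n by apply: lt_le_trans aC1; rewrite invr_gt0.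
  by rewrite pmulr_lgt0 // invr_gt0.
rewrite /p /sphere_prob; set A := (X in S n `&` X).
have le : (set_card (subsphere P n : set (raag Gamma)) + set_card (S n `&` A) <= a n)%N.
  rewrite /set_card.
  have fS : finite_set (S n) by apply: finite_sphere.
  have f1 := @finite_subsphere V Gamma Gamma_sym Gamma_irr P n.
  have f2 : finite_set (S n `&` A) by apply: sub_finite_set (@subIsetl _ _ _) fS.
  rewrite -cardfsUI -fset_setU // -fset_setI //.
  have -> : (subsphere P n : set (raag Gamma)) `&` (S n `&` A) = set0.
    apply/seteqP; split=> // g [gP [_ /andP[]]].
    have := excursion_le R Gamma_sym Gamma_irr (subsphere_run_bounded Gamma_sym Gamma_irr nPv gP).
    rewrite ler_pdivlMr // => h1 h2.
    have := le_trans h2 h1; rewrite leNgt => /negP; case.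
    by rewrite mulr_gt0.
  rewrite fset_set0 cardfs0 addn0; apply: set_card_sub => //.
  by move=> g [/(subsphere_sphere Gamma_sym Gamma_irr)|[]].
have e : (set_card (subsphere P n : set (raag Gamma)))%:R <=
    (a n)%:R * (1 - (set_card (S n `&` A))%:R / (a n)%:R) :> R.
  rewrite mulrBr mulr1 mulrCA mulfV ?gt_eqF // mulr1 lerBrDr -natrD ler_nat //.
apply: le_trans (_ : (a n)%:R * (1 - (set_card (S n `&` A))%:R / (a n)%:R) / lam ^+ n <= _).
  by rewrite ler_pM2r // invr_gt0.
rewrite mulrAC ler_wpM2r //.
rewrite subr_ge0 ler_pdivrMr // mul1r ler_nat.
by apply: leq_trans le; rewrite leq_addl.
Unshelve. all: by end_near. Qed.

(** P is the component of x in the opposite graph, so it commutes with its complement. The vertex y,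
    outside P, makes the factor on P negligible, and x does the same for the other factor. *)
Lemma growth_excursion_irreducible :
  pure_exponential_growth R RG ->
  (forall v : V, log_excursion R (vertex_group Gamma v)) -> raag_irreducible Gamma.
Proof.
move=> [lam1 [C [C0 aC]]] logs x y; apply: contrapT => /negP nxy.
set lam := growth_rate R RG in lam1 aC.
have lam0 : 0 < lam by apply: lt_trans lam1; rewrite ltr01.
pose P : pred V := connect (opposite_graph Gamma) x.
have Px : P x by apply: connect0.
have PG u w : P u -> ~~ P w -> Gamma u w.
  move=> Pu nPw; apply: contraNT nPw => nG; apply: connect_trans Pu _.
  have [->|uw] := eqVneq u w; first exact: connect0.
  by apply: connect1; rewrite /opposite_graph uw nG.
have lamn n : 0 < lam ^+ n by rewrite exprn_gt0.
have bounded (Q : pred V) (v : V) : ~~ Q v -> exists D : R, forall m,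
    \sum_(0 <= i < m) (set_card (subsphere Q i : set (raag Gamma)))%:R / lam ^+ i <= D.
  move=> nQv; apply: submultiplicative_sum_bounded.
  - by move=> n; rewrite divr_ge0 // ltW.
  - move=> n m; rewrite mulrACA -natrM -invfM -exprD ler_pM2r ?invr_gt0 // ler_nat.
    exact: subsphere_submult.
  - exact: (subsphere_negligible nQv lam0 C0 aC (logs v)).
have nnPx : ~~ predC P x by rewrite /= Px.
have [D1 D1P] := bounded P y nxy; have [D2 D2P] := bounded (predC P) x nnPx.
set b := (fun i : nat =>
  (set_card (subsphere P i : set (raag Gamma)))%:R / lam ^+ i) in D1P.
set c := (fun i : nat =>
  (set_card (subsphere (predC P) i : set (raag Gamma)))%:R / lam ^+ i) in D2P.
have b0 n : 0 <= b n by rewrite divr_ge0 // ltW.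
have c0 n : 0 <= c n by rewrite divr_ge0 // ltW.
have low n : C^-1 <= \sum_(0 <= i < n.+1) b i * c (n - i)%N.
  have /andP[aC1 _] := aC n; apply: le_trans aC1 _.
  rewrite ler_pdivrMr // mulr_suml.
  apply: le_trans (_ : (\sum_(0 <= i < n.+1) set_card (subsphere P i : set (raag Gamma)) *
     set_card (subsphere (predC P) (n - i) : set (raag Gamma)))%:R <= _).
    by rewrite ler_nat; apply: sphere_prod_le.
  rewrite natr_sum; apply: ler_sum_nat => i /andP[_ iN].
  have -> : lam ^+ n = lam ^+ i * lam ^+ (n - i) by rewrite -exprD subnKC.
  rewrite /b /c natrM le_eqVlt; apply/orP; left; apply/eqP; field.
  by rewrite !gt_eqF.
(* With this m, the m terms of size at least 1/C add up to more than D1 * D2. *)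
pose m := (Num.truncn (C * (D1 * D2))).+1.
have := convolution_sum_le m b0 c0; apply/negP; rewrite -ltNge.
apply: le_lt_trans (_ : D1 * D2 < _); first by apply: ler_pM => //; apply: sumr_ge0.
apply: lt_le_trans (_ : \sum_(0 <= n < m) C^-1 <= _); last exact: ler_sum.
rewrite sumr_const_nat subn0 -mulr_natr ltr_pdivlMl //.
exact: truncnS_gt.
Qed.

End Backward.

(** * The equivalence, with the growth bounds put in the required form *)

Theorem theorem3 (R : realType) (V : finType) (Gamma : rel V)
    (Gamma_sym : symmetric Gamma) (Gamma_irr : irreflexive Gamma)
    (nonelem : raag_non_elementary V) :
  raag_irreducible Gamma <->
  pure_exponential_growth R (raag_relators Gamma) /\
  forall v : V, log_excursion R (vertex_group Gamma v).
Proof.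
split=> [irred|[growth logs]]; last first.
  exact: growth_excursion_irreducible growth logs.
have [lam [K [lam1 lamE supK lamK]]] := irreducible_growth R Gamma_sym Gamma_irr irred nonelem.
split; last by move=> v; apply: (excursion_log Gamma_sym Gamma_irr lam1 supK lamK).
split; first by rewrite /exponential_growth lamE.
have K1 : (1 <= K%:R :> R)%R.
  by have [] := lamK 0%N; rewrite !expr0 mulr1 => h1 h2; apply: le_trans h2.
have K0 : (0 < K%:R :> R)%R by apply: lt_le_trans K1.
(* C = K works: the quotient is at least 1, hence at least 1/K. *)
exists (K%:R)%R; split=> // n; rewrite lamE.
have ln0 : (0 < lam ^+ n)%R by rewrite exprn_gt0 // (lt_trans ltr01).
have [lo hi] := lamK n; rewrite ler_pdivrMr // hi andbT ler_pdivlMr //.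
apply: le_trans lo; rewrite ler_piMl ?(ltW ln0) // invf_le1 //.
Qed.
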